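(* Let $\nu$ be a finite (positive, nonzero) Borel measure on $\mathbb{R}^m$ with compact support, and let $d\ge 1$. Then $\mathcal{L}|_{[0,1]^d}\times\nu$ is a spectral measure on $\mathbb{R}^{d+m}$ if and only if $\nu$ is a spectral measure on $\mathbb{R}^m$.
   Context: For $\lambda\in\mathbb{R}^d$ write $e_\lambda(x)=e^{2\pi i\langle\lambda,x\rangle}$. A finite positive Borel measure $\tau$ on $\mathbb{R}^d$ is a spectral measure if there is a countable set $\Lambda\subset\mathbb{R}^d$, called a spectrum of $\tau$, such that $\{e_\lambda:\lambda\in\Lambda\}$ is an orthogonal basis of $L^2(\tau)$. $\mathcal{L}|_{\Omega}$ denotes Lebesgue measure restricted to the measurable set $\Omega$. *)

(* Defs.v *)
From HB Require Import structures.
From mathcomp Require Import all_boot all_order all_algebra.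
From mathcomp Require Import complex.
From mathcomp Require Import all_classical all_reals all_analysis.

Set Implicit Arguments.
Unset Strict Implicit.
Unset Printing Implicit Defensive.

Import Order.TTheory GRing.Theory Num.Theory.
Import numFieldNormedType.Exports.

Local Open Scope classical_set_scope.
Local Open Scope ring_scope.

(* The points of R^n are the row vectors ['rV[R]_n], with the topology provided
   by the library and its Borel sigma-algebra. *)
Section borel_matrix.
Context (R : realType) (m n : nat).

HB.instance Definition _ := @isMeasurable.Build
  (sigma_display (@open 'M[R]_(m, n))) 'M[R]_(m, n)
  <<s @open 'M[R]_(m, n) >> (@sigma_algebra0 _ setT _) (@sigma_algebraC _ _)
  (@sigma_algebra_bigcup _ setT _).

Lemma borel_mxE :
  (measurable : set (set 'M[R]_(m, n))) = <<s @open 'M[R]_(m, n) >>.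
Proof. by []. Qed.

Lemma open_measurable_mx (A : set 'M[R]_(m, n)) : open A -> measurable A.
Proof. exact: sub_sigma_algebra. Qed.

Lemma measurable_coord (i : 'I_m) (j : 'I_n) :
  measurable_fun setT (fun M : 'M[R]_(m, n) => M i j).
Proof.
apply: (measurability _ (measurable_realfun.RGenOpens.measurableE R)).
move=> _ [_ [a [b ->] <-]]; rewrite setTI.
apply: open_measurable_mx.
have /continuousP := @coord_continuous R m n i j; apply.
exact: interval_open.
Qed.

Lemma mx_ballE (x : 'M[R]_(m, n)) (e : R) : 0 < e ->
  ball x e = [set y | forall i j, ball (x i j) e (y i j)].
Proof. by move=> e0; apply/seteqP; split => y /= => [[]|]. Qed.

Lemma open_mx_bigcup_ball (A : set 'M[R]_(m, n)) : open A ->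
  A = \bigcup_(p in [set p : 'M[rat]_(m, n) * nat |
        ball (map_mx ratr p.1 : 'M[R]_(m, n)) p.2.+1%:R^-1 `<=` A])
      ball (map_mx ratr p.1 : 'M[R]_(m, n)) p.2.+1%:R^-1.
Proof.
move=> oA; apply/seteqP; split; last by move=> x [p /= pA]; exact: pA.
move=> x Ax; have := open_nbhs_nbhs (conj oA Ax).
rewrite -nbhs_ballE => -[e /= e0 xeA].
have e20 : 0 < e / 2 by rewrite divr_gt0.
have [k ke] : exists k : nat, (k.+1%:R^-1 : R) < e / 2.
  exists (Num.truncn (e / 2)^-1).
  by rewrite invf_plt ?posrE// truncnS_gt.
have k0 : 0 < (k.+1%:R^-1 : R) by rewrite invr_gt0.
have /choice[q qP] : forall ij : 'I_m * 'I_n, exists q : rat,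
    ball (x ij.1 ij.2) k.+1%:R^-1 (ratr q : R).
  move=> [i j] /=.
  have [q] : exists q : rat,
      ratr q \in `](x i j - k.+1%:R^-1), (x i j + k.+1%:R^-1)[%R.
    by apply: rat_in_itvoo; rewrite ltrD2l gtrN.
  by exists q; rewrite ball_itv.
pose Q : 'M[rat]_(m, n) := \matrix_(i, j) q (i, j).
have xQ : ball x k.+1%:R^-1 (map_mx ratr Q : 'M[R]_(m, n)).
  by rewrite mx_ballE//= => i j; rewrite !mxE; exact: qP (i, j).
exists (Q, k) => /=; last exact: ball_sym.
move=> y Qy; apply: xeA; rewrite [e]splitr.
by apply: ball_triangle; [exact: le_ball (ltW ke) _ xQ|exact: le_ball (ltW ke) _ Qy].
Qed.

Lemma measurable_fun_mxP d (T : measurableType d) (f : T -> 'M[R]_(m, n)) :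
  measurable_fun setT f <-> forall i j, measurable_fun setT (fun t => f t i j).
Proof.
split=> [mf i j|mf].
  exact: (measurableT_comp (measurable_coord i j) mf).
apply: (measurability (@open 'M[R]_(m, n))) => //.
move=> _ [A oA <-]; rewrite setTI (open_mx_bigcup_ball oA) preimage_bigcup.
rewrite bigcup_mkcond; apply: countable_bigcupT_measurable => // -[q k].
case: ifPn => // _.
rewrite mx_ballE ?invr_gt0//=.
rewrite [X in measurable X](_ : _ = \bigcap_(ij in [set: 'I_m * 'I_n])
    ((fun t => f t ij.1 ij.2) @^-1`
      ball (ratr (q ij.1 ij.2) : R) k.+1%:R^-1)).
  apply: fin_bigcap_measurable => // -[i j] _ /=.
  rewrite -[X in measurable X]setTI; apply: mf => //.
  by rewrite ball_itv; exact: measurable_itv.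
apply/seteqP; split => t /=.
  by move=> tb [i j] _ /=; have := tb i j; rewrite mxE.
by move=> tb i j; have := tb (i, j) I; rewrite /= mxE.
Qed.

End borel_matrix.

Section product_rV.
Context (R : realType) (d m : nat).

Let cat (p : 'rV[R]_d * 'rV[R]_m) : 'rV[R]_(d + m) := row_mx p.1 p.2.

Lemma measurable_row_mx : measurable_fun setT cat.
Proof.
apply/measurable_fun_mxP => i j.
rewrite /cat; case: (split_ordP j) => k ->.
  under eq_fun do rewrite row_mxEl.
  exact: (measurableT_comp (measurable_coord i k) measurable_fst).
under eq_fun do rewrite row_mxEr.
exact: (measurableT_comp (measurable_coord i k) measurable_snd).
Qed.

(* The product measure on [R^d * R^m], transported to R^(d + m). *)
Definition product_rV (mu : set 'rV[R]_d -> \bar R)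
    (nu : set 'rV[R]_m -> \bar R) : set 'rV[R]_(d + m) -> \bar R :=
  pushforward (mu \x nu)%E (fun p => row_mx p.1 p.2).

Section measure.
Context (mu : {measure set 'rV[R]_d -> \bar R})
        (nu : {sigma_finite_measure set 'rV[R]_m -> \bar R}).

Let pm : {measure set 'rV[R]_(d + m) -> \bar R} :=
  measure_function_pushforward__canonical__measure_function_Measure
    (mu \x nu)%E measurable_row_mx.

HB.instance Definition _ := isMeasure.Build _ _ _ (product_rV mu nu)
  (measure0 pm) (measure_ge0 pm) (@measure_semi_sigma_additive _ _ _ pm).

End measure.
End product_rV.

Section lebesgue_rV.
Context (R : realType).

Definition cons_rV n (p : 'rV[R]_n * R) : 'rV[R]_n.+1 :=
  row_mx (p.2%:M : 'rV_1) p.1.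

Lemma measurable_cons_rV n : measurable_fun setT (@cons_rV n).
Proof.
apply/(@measurable_fun_mxP R 1 n.+1) => i j.
rewrite /cons_rV.
change (measurable_fun setT (fun p : 'rV[R]_n * R =>
  (row_mx (p.2%:M : 'rV_1) p.1 : 'rV_(1 + n)) i j)).
case: (@split_ordP 1 n j) => k ->.
  under eq_fun do rewrite row_mxEl !ord1 mxE mulr1n.
  exact: measurable_snd.
under eq_fun do rewrite row_mxEr.
exact: (measurableT_comp (measurable_coord i k) measurable_fst).
Qed.

Definition lebesgue_cons n (mu : set 'rV[R]_n -> \bar R) :
    set 'rV[R]_n.+1 -> \bar R :=
  pushforward (mu \x lebesgue_measure)%E (@cons_rV n).

Section measure.
Context n (mu : {measure set 'rV[R]_n -> \bar R}).

Let pm : {measure set 'rV[R]_n.+1 -> \bar R} :=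
  measure_function_pushforward__canonical__measure_function_Measure
    (mu \x lebesgue_measure)%E (@measurable_cons_rV n).

HB.instance Definition _ := isMeasure.Build _ _ _ (lebesgue_cons mu)
  (measure0 pm) (measure_ge0 pm) (@measure_semi_sigma_additive _ _ _ pm).

End measure.

(* Lebesgue measure on R^n: the n-fold product of [lebesgue_measure]; R^0 is a
   point, of mass 1. *)
Fixpoint lebesgue_rV n : {measure set 'rV[R]_n -> \bar R} :=
  match n with
  | 0 => \d_(0 : 'rV[R]_0)
  | n'.+1 => lebesgue_cons (lebesgue_rV n')
  end.

Definition box n (a b : 'rV[R]_n) : set 'rV[R]_n :=
  [set x | forall i, a 0 i <= x 0 i <= b 0 i].

Lemma measurable_box n (a b : 'rV[R]_n) : measurable (box a b).
Proof.
rewrite [X in measurable X](_ : _ = \bigcap_(i in [set: 'I_n])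
    ((fun x : 'rV[R]_n => x 0 i) @^-1` `[a 0 i, b 0 i])).
  apply: fin_bigcap_measurable => // i _.
  rewrite -[X in measurable X]setTI; apply: measurable_coord => //.
apply/seteqP; split => x /=.
  by move=> xab i _ /=; rewrite in_itv/=; exact: xab.
by move=> xab i; have := xab i I; rewrite /= in_itv.
Qed.

Lemma lebesgue_rV_box n (a b : 'rV[R]_n) : (forall i, a 0 i <= b 0 i) ->
  lebesgue_rV n (box a b) = (\prod_(i < n) (b 0 i - a 0 i))%:E.
Proof.
elim: n a b => [|n IH] a b ab.
  by rewrite big_ord0 /= diracE mem_set// => -[].
rewrite /= /lebesgue_cons /pushforward.
pose tl (x : 'rV[R]_n.+1) : 'rV[R]_n := \row_i x 0 (lift ord0 i).
rewrite [X in product_measure1 _ _ X](_ : _ =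
    box (tl a) (tl b) `*` `[a 0 ord0, b 0 ord0]%classic); last first.
  have H0 p : (cons_rV p : 'rV[R]_n.+1) 0 ord0 = p.2.
    have -> : ord0 = lshift n (ord0 : 'I_1) :> 'I_(1 + n) by apply/val_inj.
    by rewrite /cons_rV (@row_mxEl _ 1 1 n) mxE mulr1n.
  have HS p i : (cons_rV p : 'rV[R]_n.+1) 0 (lift ord0 i) = p.1 0 i.
    have -> : lift ord0 i = rshift 1 i :> 'I_(1 + n) by apply/val_inj.
    by rewrite /cons_rV (@row_mxEr _ 1 1 n).
  apply/seteqP; split => -[x t] /=.
    move=> abx; split; last first.
      by have := abx ord0; rewrite in_itv/= H0.
    by move=> i; have := abx (lift ord0 i); rewrite HS !mxE.
  rewrite in_itv/= => -[xab tab] i.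
  case: (unliftP ord0 i) => [j|] ->; rewrite ?H0 ?HS//=.
  by have := xab j; rewrite !mxE.
rewrite product_measure1E//=; last exact: measurable_box.
rewrite IH; last by move=> i; rewrite !mxE.
rewrite lebesgue_measure_itv/= lte_fin.
rewrite big_ord_recl.
have -> : \prod_(i < n) (tl b 0 i - tl a 0 i) =
   \prod_(i < n) (b 0 (lift ord0 i) - a 0 (lift ord0 i)).
  by apply: eq_bigr => i _; rewrite !mxE.
rewrite lt_neqAle ab andbT; case: eqVneq => [->|_] /=.
  by rewrite subrr mul0r mule0.
by rewrite -EFinB -EFinM mulrC.
Qed.

Definition unit_cube (d : nat) : set 'rV[R]_d :=
  box (const_mx 0) (const_mx 1).
Arguments unit_cube : clear implicits.

Lemma measurable_unit_cube (d : nat) : measurable (unit_cube d).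
Proof. exact: measurable_box. Qed.

End lebesgue_rV.
Arguments unit_cube : clear implicits.
Arguments measurable_unit_cube : clear implicits.

Definition msupport (R : realType) n (mu : set 'rV[R]_n -> \bar R) :
    set 'rV[R]_n :=
  [set x | forall U, open U -> U x -> (0 < mu U)%E].

Section complex_L2.
Context d (T : measurableType d) (R : realType).
Implicit Types (mu : {measure set T -> \bar R}) (f g : T -> R[i]).

Definition cmeasurable_fun f :=
  measurable_fun setT (fun x => complex.Re (f x)) /\
  measurable_fun setT (fun x => complex.Im (f x)).

Definition cintegral mu f : R[i] :=
  (Rintegral mu setT (fun x => complex.Re (f x)) +i*
   Rintegral mu setT (fun x => complex.Im (f x)))%C.

Definition L2norm mu f : \bar R :=
  'N[mu]_2%:E[EFin \o (@ComplexField.Normc.normc R \o f)]%E.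

(* L^2(mu) is represented by its functions, before identification up to
   mu-almost everywhere equality. *)
Definition L2fun mu f := cmeasurable_fun f /\ (L2norm mu f < +oo)%E.

Definition L2dot mu f g : R[i] := cintegral mu (fun x => f x * (g x)^*%C).

(* The family (b i), i in D, is an orthogonal basis of the Hilbert space
   L^2(mu): nonzero pairwise orthogonal vectors with dense linear span. *)
Definition L2_orthogonal_basis mu (I : Type) (D : set I) (b : I -> T -> R[i]) :=
  [/\ forall i, D i -> L2fun mu (b i) /\ L2norm mu (b i) <> 0%E,
      forall i j, D i -> D j -> i <> j -> L2dot mu (b i) (b j) = 0 &
      forall f, L2fun mu f -> forall e : R, 0 < e ->
        exists (k : nat) (s : 'I_k -> I) (c : 'I_k -> R[i]),
          (forall l, D (s l)) /\
          (L2norm mu (fun x => (f x - \sum_(l < k) c l * b (s l) x)%R)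
             < e%:E)%E].

End complex_L2.

Section spectral.
Context (R : realType) (n : nat).

Definition dotprod (l x : 'rV[R]_n) : R := \sum_(i < n) l 0 i * x 0 i.

(* [e_l x = exp (2 pi i <l, x>)] *)
Definition expchar (l x : 'rV[R]_n) : R[i] :=
  let t := 2 * pi * dotprod l x in (cos t +i* sin t)%C.

Definition is_spectrum (tau : {measure set 'rV[R]_n -> \bar R})
    (L : set 'rV[R]_n) :=
  countable L /\ L2_orthogonal_basis tau L expchar.

Definition spectral_measure (tau : {measure set 'rV[R]_n -> \bar R}) :=
  (tau setT < +oo)%E /\ exists L, is_spectrum tau L.

End spectral.

(* Main.v *)
(** Consecutive cylinders: the measure is obtained from [nu] by [d] successive
    products with Lebesgue measure on [0, 1], so it suffices to treat a single
    product rho x dt, whose exponentials are e_l(x) e_s(t).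

    If L is a spectrum of rho, then L x Z is one of rho x dt.  Completeness of
    the integer exponentials on [0, 1] is elementary: a half circle
    sin (2 pi (t - a)) > 0 is a bounded pointwise limit of polynomials in its
    sine, and half circles generate the Borel sets.

    Conversely let L be a spectrum of rho x dt.  Group the frequencies (l, s)
    by the class of s modulo Z.  Frequencies in different classes are
    orthogonal because of their l-component alone, so multiplying one class by
    any e_u(t) keeps it orthogonal to all the others; the closed span of a class
    is therefore invariant under such multiplications, and replacing every s by
    its integer part preserves orthogonality and completeness.  The frequencies
    with integer part 0 then form a spectrum of rho. *)
From HB Require Import structures.
Require Import Defs.
From mathcomp Require Import all_boot all_order all_algebra.
From mathcomp Require Import complex ring lra zify finmap.
From mathcomp Require Import all_classical all_reals all_analysis.
From mathcomp Require Import measurable_realfun.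

Set Implicit Arguments.
Unset Strict Implicit.
Unset Printing Implicit Defensive.

Import Order.TTheory GRing.Theory Num.Theory.
Import numFieldNormedType.Exports.

Local Open Scope classical_set_scope.
Local Open Scope ring_scope.

(** The inner product of two product exponentials factors into the [rho] inner product of their
    l-parts times the integral of e_(s - s') over [0, 1], and this integral is 0 exactly when s - s'
    is a nonzero integer. So across classes the vanishing must come from [rho], which does not see s
    and hence survives any change of s; within a class, passing to integer parts keeps all
    differences.

    L^2 is handled through functions, without quotients, closed subspaces or projections. Membership
    in a closed span is the predicate [approximable], and invariance becomes a manipulation of
    finite sums: approximate an exponential that lies outside the family, discard by Pythagoras the
    terms of the other classes, then multiply by a factor of modulus 1, which leaves the error
    unchanged. The same discarding isolates integer part 0, since f(x) times the constant 1 is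
    orthogonal to e_k(t) for every integer k other than 0.

    Density is proved on indicators of a generating family stable under intersection and spread to
    L^2 by Dynkin's theorem and simple functions; this serves both for [0, 1] and for the
    product. *)

(** * Complex moduli and measurability of complex functions *)

Section complex_numbers.
Context (R : realType).
Implicit Types z w : R[i].

Definition sqnormc z : R := complex.Re z ^+ 2 + complex.Im z ^+ 2.

Lemma ReD z w : complex.Re (z + w) = complex.Re z + complex.Re w.
Proof. by case: z w => [a b] [c d]. Qed.

Lemma ImD z w : complex.Im (z + w) = complex.Im z + complex.Im w.
Proof. by case: z w => [a b] [c d]. Qed.

Lemma ReM z w : complex.Re (z * w) =
  complex.Re z * complex.Re w - complex.Im z * complex.Im w.
Proof. by case: z w => [a b] [c d]. Qed.

Lemma ImM z w : complex.Im (z * w) =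
  complex.Re z * complex.Im w + complex.Im z * complex.Re w.
Proof. by case: z w => [a b] [c d]. Qed.

Lemma Re_conjc z : complex.Re (z^*)%C = complex.Re z.
Proof. by case: z. Qed.

Lemma Im_conjc z : complex.Im (z^*)%C = - complex.Im z.
Proof. by case: z. Qed.

Lemma ReN z : complex.Re (- z) = - complex.Re z.
Proof. by case: z. Qed.

Lemma ImN z : complex.Im (- z) = - complex.Im z.
Proof. by case: z. Qed.

Lemma sqnormc_ge0 z : 0 <= sqnormc z.
Proof. by rewrite addr_ge0 ?sqr_ge0. Qed.

Lemma sqnormcM z w : sqnormc (z * w) = sqnormc z * sqnormc w.
Proof. by rewrite /sqnormc ReM ImM; ring. Qed.

Lemma sqnormcN z : sqnormc (- z) = sqnormc z.
Proof. by rewrite /sqnormc ReN ImN; ring. Qed.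

Lemma sqnormc_conjc z : sqnormc (z^*)%C = sqnormc z.
Proof. by rewrite /sqnormc Re_conjc Im_conjc; ring. Qed.

Lemma sqnormcD z w : sqnormc (z + w) =
  sqnormc z + sqnormc w + 2 * complex.Re (z * (w^*)%C).
Proof. by rewrite /sqnormc ReM Re_conjc Im_conjc ReD ImD; ring. Qed.

Lemma le_sqnormcD z w : sqnormc (z + w) <= 2 * sqnormc z + 2 * sqnormc w.
Proof.
rewrite /sqnormc ReD ImD -subr_ge0.
set p := (X in 0 <= X); have -> : p = (complex.Re z - complex.Re w) ^+ 2 +
  (complex.Im z - complex.Im w) ^+ 2 by rewrite /p; ring.
by rewrite addr_ge0 ?sqr_ge0.
Qed.

(** A crude arithmetic-geometric bound. Only the integrability of products of L^2 functions is drawn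
    from it, so the constant is immaterial. *)
Lemma norm_ab_cd_le (a b c d : R) :
  `|a * c + b * d| <= a ^+ 2 + b ^+ 2 + (c ^+ 2 + d ^+ 2).
Proof.
have ? := sqr_ge0 (a - c); have ? := sqr_ge0 (b - d).
have ? := sqr_ge0 (a + c); have ? := sqr_ge0 (b + d).
have ? := sqr_ge0 a; have ? := sqr_ge0 b; have ? := sqr_ge0 c.
have ? := sqr_ge0 d.
by rewrite ler_norml; apply/andP; split; lra.
Qed.

Lemma le_Re_sqnormc z w :
  `|complex.Re (z * w)| <= sqnormc z + sqnormc w.
Proof.
rewrite /sqnormc ReM -mulrN (le_trans (norm_ab_cd_le _ _ _ _))//.
by rewrite sqrrN.
Qed.

Lemma le_Im_sqnormc z w :
  `|complex.Im (z * w)| <= sqnormc z + sqnormc w.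
Proof.
rewrite /sqnormc ImM (le_trans (norm_ab_cd_le _ _ _ _))//.
by rewrite (addrC (complex.Im w ^+ 2)).
Qed.

Lemma normc_sqr z : Normc.normc z `^ 2 = sqnormc z.
Proof.
case: z => a b; rewrite /= powR_mulrn ?sqrtr_ge0// sqr_sqrtr//.
exact: sqnormc_ge0 (a +i* b)%C.
Qed.

End complex_numbers.

Section complex_measurable.
Context d (T : measurableType d) (R : realType).
Implicit Types f g : T -> R[i].

Lemma cmeasurable_cst (c : R[i]) : cmeasurable_fun (fun _ : T => c).
Proof. by split; exact: measurable_cst. Qed.

Lemma cmeasurableD f g : cmeasurable_fun f -> cmeasurable_fun g ->
  cmeasurable_fun (fun x => f x + g x).
Proof.
move=> [mf1 mf2] [mg1 mg2]; split.
  by under eq_fun do rewrite ReD; exact: measurable_funD.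
by under eq_fun do rewrite ImD; exact: measurable_funD.
Qed.

Lemma cmeasurableM f g : cmeasurable_fun f -> cmeasurable_fun g ->
  cmeasurable_fun (fun x => f x * g x).
Proof.
move=> [mf1 mf2] [mg1 mg2]; split.
  by under eq_fun do rewrite ReM; apply: measurable_funB; exact: measurable_funM.
by under eq_fun do rewrite ImM; apply: measurable_funD; exact: measurable_funM.
Qed.

Lemma cmeasurable_conjc f : cmeasurable_fun f ->
  cmeasurable_fun (fun x => (f x)^*%C).
Proof.
move=> [mf1 mf2]; split; first by under eq_fun do rewrite Re_conjc.
by under eq_fun do rewrite Im_conjc; exact: measurable_funN.
Qed.

Lemma cmeasurable_real (f : T -> R) : measurable_fun setT f ->
  cmeasurable_fun (fun x => (f x)%:C%C).
Proof. by move=> mf; split => //=; exact: measurable_cst. Qed.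

Lemma cmeasurable_comp d' (T' : measurableType d') (h : T' -> T) f :
  measurable_fun setT h -> cmeasurable_fun f -> cmeasurable_fun (f \o h).
Proof.
move=> mh [mf1 mf2]; split.
  exact: (measurableT_comp mf1 mh).
exact: (measurableT_comp mf2 mh).
Qed.

Lemma measurable_sqnormc f : cmeasurable_fun f ->
  measurable_fun setT (fun x => sqnormc (f x)).
Proof. by move=> [mf1 mf2]; apply: measurable_funD; exact: measurable_funX. Qed.

End complex_measurable.

(** * Square-integrable functions and their squared norm *)

Section L2.
Context d (T : measurableType d) (R : realType) (mu : {measure set T -> \bar R}).
Implicit Types f g : T -> R[i].

Definition cintegrable f :=
  mu.-integrable setT (fun x => (complex.Re (f x))%:E) /\
  mu.-integrable setT (fun x => (complex.Im (f x))%:E).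

Lemma integrable_le (f g : T -> R) : measurable_fun setT f ->
  (forall x, `|f x| <= g x) -> mu.-integrable setT (fun x => (g x)%:E) ->
  mu.-integrable setT (fun x => (f x)%:E).
Proof.
move=> mf fg; apply: le_integrable => //; first exact/measurable_EFinP.
by move=> x _; rewrite lee_fin (le_trans (fg x))// ler_norm.
Qed.

Lemma integrableDr (f g : T -> R) :
  mu.-integrable setT (fun x => (f x)%:E) ->
  mu.-integrable setT (fun x => (g x)%:E) ->
  mu.-integrable setT (fun x => (f x + g x)%:E).
Proof.
by move=> fi gi; exact: (@integrableD _ _ _ mu setT _ (EFin \o f) (EFin \o g)).
Qed.

Lemma integrableZr (k : R) (f : T -> R) :
  mu.-integrable setT (fun x => (f x)%:E) ->
  mu.-integrable setT (fun x => (k * f x)%:E).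
Proof. by move=> fi; exact: (@integrableZl _ _ _ mu setT _ k (EFin \o f)). Qed.

Lemma cintegralD f g : cintegrable f -> cintegrable g ->
  cintegral mu (fun x => f x + g x) = cintegral mu f + cintegral mu g.
Proof.
move=> [f1 f2] [g1 g2]; rewrite /cintegral.
under eq_Rintegral do rewrite ReD; rewrite RintegralD//.
by under [X in (_ +i* X)%C]eq_Rintegral do rewrite ImD; rewrite RintegralD.
Qed.

Lemma cintegralZ (c : R[i]) f : cintegrable f ->
  cintegral mu (fun x => c * f x) = c * cintegral mu f.
Proof.
move=> [f1 f2]; rewrite /cintegral; case: c => a b.
have -> : \int[mu]_x complex.Re ((a +i* b)%C * f x) =
    a * \int[mu]_x complex.Re (f x) - b * \int[mu]_x complex.Im (f x).
  under eq_Rintegral do rewrite ReM/=.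
  by rewrite RintegralB//; [rewrite !RintegralZl|exact: integrableZr..].
have -> : \int[mu]_x complex.Im ((a +i* b)%C * f x) =
    a * \int[mu]_x complex.Im (f x) + b * \int[mu]_x complex.Re (f x).
  under eq_Rintegral do rewrite ImM/=.
  by rewrite RintegralD//; [rewrite !RintegralZl|exact: integrableZr..].
by [].
Qed.

Lemma eq_cintegral f g : f =1 g -> cintegral mu f = cintegral mu g.
Proof. by move=> /funext ->. Qed.

Definition L2int f := cmeasurable_fun f /\
  mu.-integrable setT (fun x => (sqnormc (f x))%:E).

(** The squared norm is multiplicative on tensors and free of square roots; [le_norm2D], with its
    factors 2, stands in for the triangle inequality. *)
Definition norm2 f : R := \int[mu]_x sqnormc (f x).

Lemma norm2_ge0 f : 0 <= norm2 f.
Proof. by apply: Rintegral_ge0 => x _; exact: sqnormc_ge0. Qed.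

Lemma L2norm_sqr f :
  (L2norm mu f `^ 2 = \int[mu]_x (sqnormc (f x))%:E)%E.
Proof.
rewrite /L2norm powR_Lnorm//; apply: eq_integral => x _ /=.
by rewrite ger0_norm ?normc_sqr//; case: (f x) => a b /=; exact: sqrtr_ge0.
Qed.

Lemma L2norm_ge0 f : (0 <= L2norm mu f)%E.
Proof. exact: Lnorm_ge0. Qed.

Lemma L2funP f : L2fun mu f <-> L2int f.
Proof.
split=> -[mf h]; split => //.
  apply/integrableP; split.
    exact/measurable_EFinP/measurable_sqnormc.
  under eq_integral do rewrite gee0_abs ?lee_fin ?sqnormc_ge0//.
  by rewrite -L2norm_sqr poweR_lty.
move/integrableP : h => [_].
under eq_integral do rewrite gee0_abs ?lee_fin ?sqnormc_ge0//.
by rewrite -L2norm_sqr; apply: lty_poweRy.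
Qed.

Lemma norm2E f : L2int f -> (norm2 f)%:E = (\int[mu]_x (sqnormc (f x))%:E)%E.
Proof.
by move=> [_ fi]; rewrite /norm2 /Rintegral fineK//; exact: integrable_fin_num.
Qed.

Lemma L2norm_lt f (e : R) : L2int f -> 0 < e ->
  (L2norm mu f < e%:E)%E = (norm2 f < e ^+ 2).
Proof.
move=> fL2 e0; have [_ foo] := (L2funP f).2 fL2.
have := L2norm_sqr f; rewrite -norm2E//.
have /fineK <- : L2norm mu f \is a fin_num by rewrite ge0_fin_numE// L2norm_ge0.
have f0 : 0 <= fine (L2norm mu f) by rewrite fine_ge0// L2norm_ge0.
rewrite poweR_EFin => -[<-]; rewrite lte_fin powR_mulrn//.
by rewrite ltr_pXn2r// nnegrE ltW.
Qed.

Lemma L2norm_eq0 f : L2int f -> L2norm mu f = 0%E <-> norm2 f = 0.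
Proof.
move=> fL2; have := L2norm_sqr f; rewrite -norm2E// => h; split => f0.
  by move: h; rewrite f0 poweR0r// => -[].
by move: h; rewrite f0 => /poweR_eq0_eq0; apply; exact: L2norm_ge0.
Qed.

Lemma L2intD f g : L2int f -> L2int g -> L2int (fun x => f x + g x).
Proof.
move=> [mf fi] [mg gi]; have mfg := cmeasurableD mf mg; split => //.
apply: (@integrable_le _ (fun x => 2 * sqnormc (f x) + 2 * sqnormc (g x))).
- exact: measurable_sqnormc.
- by move=> x; rewrite ger0_norm ?sqnormc_ge0// le_sqnormcD.
- by apply: integrableDr; exact: integrableZr.
Qed.

Lemma L2intZ (c : R[i]) f : L2int f -> L2int (fun x => c * f x).
Proof.
move=> [mf fi]; split; first exact: cmeasurableM (cmeasurable_cst _ c) mf.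
by under eq_fun do rewrite sqnormcM; exact: integrableZr.
Qed.

Lemma L2intN f : L2int f -> L2int (fun x => - f x).
Proof.
move=> /(L2intZ (-1)); congr L2int; apply/funext => x; by rewrite mulN1r.
Qed.

Lemma L2intB f g : L2int f -> L2int g -> L2int (fun x => f x - g x).
Proof. by move=> fL2 /L2intN; exact: L2intD. Qed.

Lemma L2int0 : L2int (fun=> 0).
Proof.
split; first exact: cmeasurable_cst.
by rewrite /sqnormc/= expr0n/= addr0; exact: integrable0.
Qed.

Lemma norm2N f : norm2 (fun x => - f x) = norm2 f.
Proof. by rewrite /norm2; under eq_Rintegral do rewrite sqnormcN. Qed.

Lemma norm2Z (c : R[i]) f : L2int f ->
  norm2 (fun x => c * f x) = sqnormc c * norm2 f.
Proof.
by move=> [_ fi]; rewrite /norm2; under eq_Rintegral do rewrite sqnormcM;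
  rewrite RintegralZl.
Qed.

Lemma le_norm2D f g : L2int f -> L2int g ->
  norm2 (fun x => f x + g x) <= 2 * norm2 f + 2 * norm2 g.
Proof.
move=> fL2 gL2; rewrite /norm2 -!RintegralZl//; [|exact: gL2.2|exact: fL2.2].
rewrite -RintegralD//; [|by apply: integrableZr; case: fL2|
  by apply: integrableZr; case: gL2].
apply: le_Rintegral => //; first by case: (L2intD fL2 gL2).
  by apply: integrableDr; apply: integrableZr; [case: fL2|case: gL2].
by move=> x _; exact: le_sqnormcD.
Qed.

Lemma L2int_cintegrable f g : L2int f -> L2int g ->
  cintegrable (fun x => f x * g x).
Proof.
move=> [mf fi] [mg gi]; have [m1 m2] := cmeasurableM mf mg.
split; apply: (@integrable_le _ (fun x => sqnormc (f x) + sqnormc (g x))) => //.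
- by move=> x; exact: le_Re_sqnormc.
- exact: integrableDr.
- by move=> x; exact: le_Im_sqnormc.
- exact: integrableDr.
Qed.

Lemma L2int_conjc f : L2int f -> L2int (fun x => (f x)^*%C).
Proof.
move=> [mf fi]; split; first exact: cmeasurable_conjc.
by under eq_fun do rewrite sqnormc_conjc.
Qed.

Lemma L2dotDl f g h : L2int f -> L2int g -> L2int h ->
  L2dot mu (fun x => f x + g x) h = L2dot mu f h + L2dot mu g h.
Proof.
move=> fL gL hL; rewrite /L2dot -cintegralD; last 2 first.
- by apply: L2int_cintegrable => //; exact: L2int_conjc.
- by apply: L2int_cintegrable => //; exact: L2int_conjc.
by apply: eq_cintegral => x; rewrite mulrDl.
Qed.

Lemma L2dotZl c f h : L2int f -> L2int h ->
  L2dot mu (fun x => c * f x) h = c * L2dot mu f h.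
Proof.
move=> fL hL; rewrite /L2dot -cintegralZ; last first.
  by apply: L2int_cintegrable => //; exact: L2int_conjc.
by apply: eq_cintegral => x; rewrite mulrA.
Qed.

Lemma L2dotC f g : L2int f -> L2int g -> L2dot mu f g = (L2dot mu g f)^*%C.
Proof.
move=> fL gL; have [_ h] := L2int_cintegrable gL (L2int_conjc fL).
rewrite /L2dot /cintegral/=; congr (_ +i* _)%C.
  by apply: eq_Rintegral => x _; rewrite !ReM !Re_conjc !Im_conjc; ring.
rewrite -mulN1r -RintegralZl//; apply: eq_Rintegral => x _.
by rewrite !ImM !Re_conjc !Im_conjc; ring.
Qed.

Lemma pythagoras f g : L2int f -> L2int g -> L2dot mu f g = 0 ->
  norm2 (fun x => f x + g x) = norm2 f + norm2 g.
Proof.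
move=> fL gL /(congr1 (@complex.Re R))/= fg0; rewrite /norm2.
have [h _] := L2int_cintegrable fL (L2int_conjc gL).
under eq_Rintegral do rewrite sqnormcD.
rewrite RintegralD//; last 2 first.
  by apply: integrableDr; [case: fL|case: gL].
  exact: integrableZr.
by rewrite RintegralZl// fg0 mulr0 addr0 RintegralD//; [case: fL|case: gL].
Qed.

End L2.

(** * Approximation by finite combinations of a family *)

Section approximation.
Context d (T : measurableType d) (R : realType) (mu : {measure set T -> \bar R}).
Implicit Types f g : T -> R[i].

(** Combinations are lists of coefficient-index pairs, repetitions allowed, so that adding,
    multiplying, filtering and reindexing them are plain list operations. *)
Definition lincomb I (b : I -> T -> R[i]) (r : seq (R[i] * I)) (x : T) :=
  \sum_(p <- r) p.1 * b p.2 x.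

Definition coefs_in I (D : set I) (r : seq (R[i] * I)) :=
  all (fun p => `[< D p.2 >]) r.

(** Membership in the closed span. Bounding the squared norm by every positive [e] amounts to
    bounding the norm by every positive [e]. *)
Definition approximable I (D : set I) (b : I -> T -> R[i]) f :=
  forall e : R, 0 < e -> exists2 r, coefs_in D r &
    norm2 mu (fun x => f x - lincomb b r x) < e.

Section family.
Context I (D : set I) (b : I -> T -> R[i]).
Hypothesis bL2 : forall i, D i -> L2int mu (b i).

Lemma lincomb_L2 r : coefs_in D r -> L2int mu (lincomb b r).
Proof.
elim: r => [|[c i] r IH] /=.
  move=> _; have -> : lincomb b [::] = fun=> 0.
    by apply/funext => x; rewrite /lincomb big_nil.
  exact: L2int0.
move=> /andP[/asboolP Di /IH h].
have -> : lincomb b ((c, i) :: r) = fun x => c * b i x + lincomb b r x.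
  by apply/funext => x; rewrite /lincomb big_cons.
by apply: L2intD => //; apply: L2intZ; exact: bL2.
Qed.

Lemma approximable_lincomb r : coefs_in D r -> approximable D b (lincomb b r).
Proof.
move=> Dr e e0; exists r => //.
under eq_fun do rewrite subrr.
rewrite /norm2 /Rintegral integral0_eq//= => x _.
by rewrite /sqnormc/= expr0n/= addr0.
Qed.

Lemma approximable_lim f : L2int mu f ->
  (forall e : R, 0 < e -> exists g,
    [/\ L2int mu g, approximable D b g & norm2 mu (fun x => f x - g x) < e]) ->
  approximable D b f.
Proof.
(* [le_norm2D] doubles each of the two errors, so quarters add up to [e]. *)
move=> fL h e e0; have [|g [gL ga fge]] := h (e / 4); first by rewrite divr_gt0.
have [|r Dr gr] := ga (e / 4); first by rewrite divr_gt0.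
exists r => //; have rL := lincomb_L2 Dr.
have -> : (fun x => f x - lincomb b r x) =
    (fun x => (f x - g x) + (g x - lincomb b r x)).
  by apply/funext => x; rewrite addrA subrK.
by apply: (le_lt_trans (le_norm2D (L2intB fL gL) (L2intB gL rL))); lra.
Qed.

Lemma approximableD f g : L2int mu f -> L2int mu g ->
  approximable D b f -> approximable D b g ->
  approximable D b (fun x => f x + g x).
Proof.
move=> fL gL fa ga e e0.
have [|r Dr fr] := fa (e / 4); first by rewrite divr_gt0.
have [|s Ds gs] := ga (e / 4); first by rewrite divr_gt0.
exists (r ++ s); first by rewrite /coefs_in all_cat; apply/andP.
have -> : (fun x => f x + g x - lincomb b (r ++ s) x) =
    (fun x => (f x - lincomb b r x) + (g x - lincomb b s x)).
  by apply/funext => x; rewrite /lincomb big_cat/=; ring.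
apply: (le_lt_trans (le_norm2D (L2intB fL (lincomb_L2 Dr))
  (L2intB gL (lincomb_L2 Ds)))); lra.
Qed.

Lemma approximableZ c f : L2int mu f ->
  approximable D b f -> approximable D b (fun x => c * f x).
Proof.
(* The [+ 1] keeps the divisor positive when [c] is 0. *)
move=> fL fa e e0; have c1 : 0 < sqnormc c + 1 by rewrite ltr_wpDl ?sqnormc_ge0.
have [|r Dr fr] := fa (e / (sqnormc c + 1)); first by rewrite divr_gt0.
exists [seq (c * p.1, p.2) | p <- r]; first by rewrite /coefs_in all_map.
have -> : (fun x => c * f x - lincomb b [seq (c * p.1, p.2) | p <- r] x) =
    (fun x => c * (f x - lincomb b r x)).
  apply/funext => x; rewrite mulrBr /lincomb big_map mulr_sumr/=.
  by congr (_ - _); apply: eq_bigr => p _; rewrite mulrA.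
rewrite norm2Z; last exact: L2intB (lincomb_L2 Dr).
rewrite (@le_lt_trans _ _ ((sqnormc c + 1) * norm2 mu (fun x => f x - lincomb b r x)))//.
  by rewrite ler_wpM2r ?norm2_ge0// lerDl.
by rewrite mulrC -ltr_pdivlMr.
Qed.

Lemma approximable0 : approximable D b (fun=> 0).
Proof.
have -> : (fun=> 0) = lincomb b [::] :> (T -> R[i]).
  by apply/funext => x; rewrite /lincomb big_nil.
exact: approximable_lincomb.
Qed.

Lemma L2dot_lincomb f r : coefs_in D r -> L2int mu f ->
  (forall i, D i -> L2dot mu f (b i) = 0) -> L2dot mu (lincomb b r) f = 0.
Proof.
move=> + fL fb; elim: r => [|[c i] r IH] /=.
  move=> _; rewrite /L2dot /cintegral.
  have h x : lincomb b [::] x * (f x)^*%C = 0 by rewrite /lincomb big_nil mul0r.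
  under eq_Rintegral do rewrite h.
  under [X in (_ +i* X)%C]eq_Rintegral do rewrite h.
  by rewrite /= Rintegral_cst//= mul0r.
move=> /andP[/asboolP Di Dr].
have -> : lincomb b ((c, i) :: r) = fun x => c * b i x + lincomb b r x.
  by apply/funext => x; rewrite /lincomb big_cons.
have bi := bL2 Di.
rewrite L2dotDl//; [|exact: L2intZ|exact: lincomb_L2].
by rewrite IH// addr0 L2dotZl// L2dotC// fb// conjc0 mulr0.
Qed.

End family.

(* By orthogonality, deleting from an approximation of [f] the terms orthogonal
   to [f] only improves it. *)
Lemma approximable_drop I (D P : set I) (b : I -> T -> R[i]) f :
  (forall i, D i -> L2int mu (b i)) -> L2int mu f -> approximable D b f ->
  (forall i, D i -> ~ P i -> L2dot mu f (b i) = 0) ->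
  (forall i j, D i -> D j -> P i -> ~ P j -> L2dot mu (b i) (b j) = 0) ->
  approximable (D `&` P) b f.
Proof.
move=> bL2 fL fa fP orth e /fa[r Dr fr].
pose rP := [seq p <- r | `[< P p.2 >]].
pose rN := [seq p <- r | ~~ `[< P p.2 >]].
have DrP : coefs_in (D `&` P) rP.
  rewrite /coefs_in /rP all_filter; apply: sub_all Dr => p /= /asboolP Dp.
  by apply/implyP => /asboolP Pp; apply/asboolP.
have DrN : coefs_in (D `\` P) rN.
  rewrite /coefs_in /rN all_filter; apply: sub_all Dr => p /= /asboolP Dp.
  by apply/implyP => /asboolPn Pp; apply/asboolP.
have DrP' : coefs_in D rP by apply: sub_all DrP => p /asboolP[? _]; apply/asboolP.
have DrN' : coefs_in D rN by apply: sub_all DrN => p /asboolP[? _]; apply/asboolP.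
have PL := lincomb_L2 bL2 DrP'; have NL := lincomb_L2 bL2 DrN'.
have fPL := L2intB fL PL.
exists rP => //; apply: le_lt_trans fr.
have -> : (fun x => f x - lincomb b r x) =
    (fun x => (f x - lincomb b rP x) + - lincomb b rN x).
  apply/funext => x; rewrite /lincomb /rP /rN !big_filter.
  by rewrite (bigID (fun p => `[< P p.2 >]))/= opprD addrA.
have NL' := L2intN NL.
rewrite (pythagoras fPL NL') ?norm2N ?lerDl ?norm2_ge0// L2dotC//.
have NE g : (fun x => - g x) = (fun x => (-1) * g x) :> (T -> R[i]).
  by apply/funext => x; rewrite mulN1r.
rewrite NE L2dotZl// (@L2dot_lincomb _ (D `\` P))//; last 2 first.
- by move=> i [Di _]; exact: bL2.
- move=> i [Di nPi]; have bi := bL2 _ Di.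
  rewrite L2dotDl//; last exact: L2intN.
  rewrite fP// add0r NE L2dotZl// (@L2dot_lincomb _ (D `&` P)) ?mulr0//.
    by move=> j [Dj _]; exact: bL2.
  move=> j [Dj Pj]; have bj := bL2 _ Dj.
  by rewrite L2dotC// orth// conjc0.
by rewrite mulr0 conjc0.
Qed.

Lemma approximable_trans I J (D : set I) (b : I -> T -> R[i])
    (D' : set J) (b' : J -> T -> R[i]) f :
  (forall i, D i -> L2int mu (b i)) -> (forall j, D' j -> L2int mu (b' j)) ->
  L2int mu f -> approximable D b f ->
  (forall i, D i -> approximable D' b' (b i)) -> approximable D' b' f.
Proof.
move=> bL bL' fL fa ba; apply: approximable_lim => // e /fa[r Dr fr].
exists (lincomb b r); split => //; first exact: lincomb_L2 Dr.
elim: r Dr {fr} => [|[c i] r IH] /=.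
  move=> _; have -> : lincomb b [::] = fun=> 0.
    by apply/funext => x; rewrite /lincomb big_nil.
  exact: approximable0.
move=> /andP[/asboolP Di Dr].
have -> : lincomb b ((c, i) :: r) = fun x => c * b i x + lincomb b r x.
  by apply/funext => x; rewrite /lincomb big_cons.
have bi := bL _ Di; apply: approximableD => //.
- exact: L2intZ.
- exact: lincomb_L2 Dr.
- by apply: approximableZ => //; exact: ba.
- exact: IH.
Qed.

Lemma approximable_reindex I J (D : set I) (b : I -> T -> R[i])
    (D' : set J) (b' : J -> T -> R[i]) (h : I -> J) f :
  (forall i, D i -> D' (h i)) -> (forall i, D i -> b i = b' (h i)) ->
  approximable D b f -> approximable D' b' f.
Proof.
move=> Dh bh fa e /fa[r Dr fr]; exists [seq (p.1, h p.2) | p <- r].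
  rewrite /coefs_in all_map; apply: sub_all Dr => p /asboolP Dp /=.
  by apply/asboolP; exact: Dh.
congr (_ < e): fr; congr norm2; apply/funext => x; congr (_ - _).
rewrite /lincomb big_map/=; elim: r Dr => [|p r IH]; rewrite ?big_nil//= !big_cons.
by move=> /andP[/asboolP Dp /IH ->]; rewrite bh.
Qed.

Lemma basisP I (D : set I) (b : I -> T -> R[i]) :
  (forall i, D i -> L2int mu (b i)) -> (forall i, D i -> norm2 mu (b i) <> 0) ->
  L2_orthogonal_basis mu D b <->
  (forall i j, D i -> D j -> i <> j -> L2dot mu (b i) (b j) = 0) /\
  (forall f, L2int mu f -> approximable D b f).
Proof.
move=> bL b0; split=> [[_ orth cpl]|[orth cpl]]; split => //.
(* [cpl] bounds the norm and [approximable] its square, whence [Num.sqrt e] here and [e ^+ 2] in the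
   converse. *)
- move=> f fL e e0; have se0 : 0 < Num.sqrt e by rewrite sqrtr_gt0.
  have [k [s [c [Ds fsc]]]] := cpl f ((L2funP mu f).2 fL) _ se0.
  pose r := [seq (c l, s l) | l <- enum 'I_k].
  have Dr : coefs_in D r.
    by rewrite /coefs_in all_map; apply/allP => l _ /=; exact/asboolP.
  exists r => //; rewrite -[ltRHS](sqr_sqrtr (ltW e0)) -L2norm_lt//; last first.
    by apply: L2intB => //; exact: lincomb_L2 Dr.
  congr (_ < _)%E: fsc; congr L2norm; apply/funext => x; congr (_ - _).
  by rewrite /lincomb big_map big_enum.
- by move=> i Di; split; [apply/L2funP; exact: bL|
    move=> /(L2norm_eq0 (bL _ Di)); exact: b0].
- move=> f /L2funP fL e e0; have [|r Dr fr] := cpl f fL (e ^+ 2).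
    by rewrite exprn_gt0.
  exists (size r), (fun l => (tnth (in_tuple r) l).2),
    (fun l => (tnth (in_tuple r) l).1); split.
    move=> l; apply/asboolP.
    exact: (all_tnthP (t := in_tuple r) Dr l).
  rewrite -L2norm_lt// in fr; last first.
    by apply: L2intB => //; exact: lincomb_L2 Dr.
  congr (_ < _)%E: fr; congr L2norm; apply/funext => x; congr (_ - _).
  by rewrite /lincomb [LHS]big_tnth.
Qed.

End approximation.

(** * Tensor products of functions on a product measure *)

Section tensor.
Context d1 d2 (T1 : measurableType d1) (T2 : measurableType d2) (R : realType).
Variables (m1 : {sigma_finite_measure set T1 -> \bar R})
  (m2 : {sigma_finite_measure set T2 -> \bar R}).

Lemma measurable_tensor (f : T1 -> R) (g : T2 -> R) :
  measurable_fun setT f -> measurable_fun setT g ->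
  measurable_fun setT (fun z : T1 * T2 => f z.1 * g z.2).
Proof.
move=> mf mg; apply: measurable_funM.
  exact: (measurableT_comp mf measurable_fst).
exact: (measurableT_comp mg measurable_snd).
Qed.

Lemma integrable_tensor (f : T1 -> R) (g : T2 -> R) :
  m1.-integrable setT (fun x => (f x)%:E) ->
  m2.-integrable setT (fun x => (g x)%:E) ->
  (m1 \x m2)%E.-integrable setT (fun z => (f z.1 * g z.2)%:E).
Proof.
move=> fi gi; have /measurable_EFinP mf := measurable_int _ fi.
have /measurable_EFinP mg := measurable_int _ gi.
apply/integrable12ltyP; first by apply/measurable_EFinP; exact: measurable_tensor.
have /integrableP[mfE foo] := fi; have /integrableP[mgE goo] := gi.
have -> : (\int[m1]_x \int[m2]_y `|(f (x, y).1 * g (x, y).2)%:E| =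
    \int[m1]_x (`|(f x)%:E| * \int[m2]_y `|(g y)%:E|))%E.
  apply: eq_integral => x _ /=.
  under eq_integral do rewrite normrM EFinM.
  rewrite ge0_integralZl//; last by apply/measurable_EFinP; exact: measurableT_comp.
rewrite ge0_integralZr//; last 2 first.
- exact: measurableT_comp.
- exact: integral_ge0.
by rewrite lte_mul_pinfty// ?integral_ge0// ge0_fin_numE// integral_ge0.
Qed.

Lemma Rintegral_tensor (f : T1 -> R) (g : T2 -> R) :
  m1.-integrable setT (fun x => (f x)%:E) ->
  m2.-integrable setT (fun x => (g x)%:E) ->
  Rintegral (m1 \x m2)%E setT (fun z => f z.1 * g z.2) =
  (\int[m1]_x f x) * (\int[m2]_y g y).
Proof.
move=> fi gi; rewrite /Rintegral -integral12_prod_meas1/=; last exact: integrable_tensor.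
transitivity (fine (\int[m1]_x ((f x)%:E * \int[m2]_y (g y)%:E))%E).
  congr fine; apply: eq_integral => x _ /=.
  by rewrite -integralZl.
rewrite -(fineK (integrable_fin_num measurableT gi)) integralZr//.
by rewrite fineM//; exact: integrable_fin_num.
Qed.

Lemma cmeasurable_tensor (f : T1 -> R[i]) (g : T2 -> R[i]) :
  cmeasurable_fun f -> cmeasurable_fun g ->
  cmeasurable_fun (fun z : T1 * T2 => f z.1 * g z.2).
Proof.
move=> mf mg; apply: cmeasurableM.
  exact: (cmeasurable_comp measurable_fst mf).
exact: (cmeasurable_comp measurable_snd mg).
Qed.

Lemma cintegral_tensor (f : T1 -> R[i]) (g : T2 -> R[i]) :
  cintegrable m1 f -> cintegrable m2 g ->
  cintegral (m1 \x m2)%E (fun z => f z.1 * g z.2) =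
  cintegral m1 f * cintegral m2 g.
Proof.
move=> [f1 f2] [g1 g2]; rewrite /cintegral; apply/eqP; rewrite eq_complex/=.
apply/andP; split; apply/eqP.
  rewrite -!Rintegral_tensor// -RintegralB//; last 2 first.
  - exact: (integrable_tensor f1 g1).
  - exact: (integrable_tensor f2 g2).
  by apply: eq_Rintegral => z _; rewrite ReM.
rewrite -!Rintegral_tensor// -RintegralD//; last 2 first.
- exact: (integrable_tensor f1 g2).
- exact: (integrable_tensor f2 g1).
by apply: eq_Rintegral => z _; rewrite ImM.
Qed.

Lemma L2int_tensor (f : T1 -> R[i]) (g : T2 -> R[i]) :
  L2int m1 f -> L2int m2 g -> L2int (m1 \x m2)%E (fun z => f z.1 * g z.2).
Proof.
move=> [mf fi] [mg gi]; split; first exact: cmeasurable_tensor.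
have := integrable_tensor fi gi; congr (_.-integrable _ _).
by apply/funext => z; rewrite sqnormcM.
Qed.

Lemma norm2_tensor (f : T1 -> R[i]) (g : T2 -> R[i]) :
  L2int m1 f -> L2int m2 g ->
  norm2 (m1 \x m2)%E (fun z => f z.1 * g z.2) = norm2 m1 f * norm2 m2 g.
Proof.
move=> [mf fi] [mg gi]; rewrite /norm2 -(Rintegral_tensor fi gi).
by apply: eq_Rintegral => z _; rewrite sqnormcM.
Qed.

Lemma L2dot_tensor (f f' : T1 -> R[i]) (g g' : T2 -> R[i]) :
  L2int m1 f -> L2int m2 g -> L2int m1 f' -> L2int m2 g' ->
  L2dot (m1 \x m2)%E (fun z => f z.1 * g z.2) (fun z => f' z.1 * g' z.2) =
  L2dot m1 f f' * L2dot m2 g g'.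
Proof.
move=> fL gL fL' gL'.
rewrite /L2dot -(@cintegral_tensor (fun x => f x * (f' x)^*%C)
  (fun x => g x * (g' x)^*%C)); last 2 first.
- by apply: L2int_cintegrable => //; exact: L2int_conjc.
- by apply: L2int_cintegrable => //; exact: L2int_conjc.
by apply: eq_cintegral => z; rewrite rmorphM/=; ring.
Qed.

(** With [s] approximating [g] and [r] approximating [f], the error splits as f (g - s) + (f - r) s.
    The tolerance for [r] depends on the norm of [s], so [s] is chosen first. *)
Lemma approximable_tensor I J (D : set I) (b : I -> T1 -> R[i])
    (D' : set J) (b' : J -> T2 -> R[i]) f g :
  (forall i, D i -> L2int m1 (b i)) -> (forall j, D' j -> L2int m2 (b' j)) ->
  L2int m1 f -> L2int m2 g ->
  approximable m1 D b f -> approximable m2 D' b' g ->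
  approximable (m1 \x m2)%E (D `*` D')
    (fun ij z => b ij.1 z.1 * b' ij.2 z.2) (fun z => f z.1 * g z.2).
Proof.
move=> bL bL' fL gL fa ga e e0.
(* Each of the two terms gets a squared norm below e / 4, doubled by [le_norm2D]. The [+ 1] in [M]
   and in [N] makes them safe divisors. *)
set M := norm2 m1 f + 1; have M0 : 0 < M by rewrite ltr_wpDl ?norm2_ge0.
have [|s Ds gs] := ga (e / (4 * M)); first by rewrite divr_gt0// mulr_gt0.
have sL := lincomb_L2 bL' Ds.
set N := norm2 m2 (lincomb b' s) + 1.
have N0 : 0 < N by rewrite ltr_wpDl ?norm2_ge0.
have [|r Dr fr] := fa (e / (4 * N)); first by rewrite divr_gt0// mulr_gt0.
have rL := lincomb_L2 bL Dr.
exists [seq (p.1 * q.1, (p.2, q.2)) | p <- r, q <- s].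
  rewrite /coefs_in; elim: (r) Dr => //= p r' IH /andP[/asboolP Dp /IH h].
  rewrite all_cat h andbT all_map; apply: sub_all Ds => q /asboolP Dq /=.
  exact/asboolP.
have -> : (fun z : T1 * T2 => f z.1 * g z.2 -
     lincomb (fun ij z => b ij.1 z.1 * b' ij.2 z.2)
     [seq (p.1 * q.1, (p.2, q.2)) | p <- r, q <- s] z) =
   (fun z => f z.1 * (g z.2 - lincomb b' s z.2) +
     (f z.1 - lincomb b r z.1) * lincomb b' s z.2).
  apply/funext => z; rewrite {1}/lincomb big_allpairs_dep/=.
  have -> : \sum_(p <- r) \sum_(q <- s) p.1 * q.1 * (b p.2 z.1 * b' q.2 z.2) =
     lincomb b r z.1 * lincomb b' s z.2.
    rewrite /lincomb mulr_suml; apply: eq_bigr => p _.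
    by rewrite mulr_sumr; apply: eq_bigr => q _; ring.
  by ring.
have gsL := L2intB gL sL; have frL := L2intB fL rL.
apply: (le_lt_trans (le_norm2D (L2int_tensor fL gsL) (L2int_tensor frL sL))).
rewrite (norm2_tensor fL gsL) (norm2_tensor frL sL).
move: gs fr; rewrite !ltr_pdivlMr ?mulr_gt0// => gs fr.
have := norm2_ge0 m2 (fun x => g x - lincomb b' s x).
have := norm2_ge0 m1 (fun x => f x - lincomb b r x).
rewrite /M /N in gs fr *; nra.
Qed.

End tensor.

(** * Change of measure and push-forward *)

Section change_of_measure.
Context (R : realType).

Lemma eq_cintegral_measure d (T : measurableType d)
    (m1 m2 : {measure set T -> \bar R}) (f : T -> R[i]) :
  (forall A, measurable A -> m1 A = m2 A) -> cintegral m1 f = cintegral m2 f.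
Proof.
move=> m12; rewrite /cintegral /Rintegral.
by congr (fine _ +i* fine _)%C; apply: eq_measure_integral => A mA _; exact: m12.
Qed.

Lemma eq_L2norm_measure d (T : measurableType d)
    (m1 m2 : {measure set T -> \bar R}) (f : T -> R[i]) :
  (forall A, measurable A -> m1 A = m2 A) -> L2norm m1 f = L2norm m2 f.
Proof.
move=> m12; rewrite /L2norm unlock/=; congr (_ `^ _)%E.
by apply: eq_measure_integral => A mA _; exact: m12.
Qed.

(** Two descriptions of a measure are set functions that need only agree on measurable sets, so one
    cannot simply be rewritten into the other; integrals depend only on the measurable values. *)
Lemma spectral_measure_eq n (m1 m2 : {measure set 'rV[R]_n -> \bar R}) :
  (forall A, measurable A -> m1 A = m2 A) ->
  spectral_measure m1 -> spectral_measure m2.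
Proof.
move=> m12 [fin [L [cL [bL orth cpl]]]]; split; first by rewrite -m12.
exists L; split => //; split.
- by move=> i /bL; rewrite /L2fun -!(eq_L2norm_measure _ m12).
- by move=> i j Li Lj ij; rewrite /L2dot -(eq_cintegral_measure _ m12); exact: orth.
- move=> f; rewrite /L2fun -(eq_L2norm_measure _ m12) => fL e /(cpl f fL)[k [s [c h]]].
  by exists k, s, c; rewrite -(eq_L2norm_measure _ m12).
Qed.

Variables (d d' : measure_display) (X : measurableType d) (Y : measurableType d').
Variables (phi : X -> Y) (mphi : measurable_fun setT phi).
Variables (mu : {measure set X -> \bar R}) (nu : {measure set Y -> \bar R}).
Hypothesis nuE : forall A, measurable A -> nu A = mu (phi @^-1` A).

Let push : {measure set Y -> \bar R} :=
  measure_function_pushforward__canonical__measure_function_Measure mu mphi.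

Let nu_push A : measurable A -> nu A = push A.
Proof. exact: nuE. Qed.

Lemma integrable_push (f : Y -> R) : measurable_fun setT f ->
  mu.-integrable setT (fun x => (f (phi x))%:E) ->
  nu.-integrable setT (fun y => (f y)%:E).
Proof.
move=> mf fi; have mfE : measurable_fun setT (EFin \o f) by exact/measurable_EFinP.
have /integrableP[_ h] : push.-integrable setT (EFin \o f).
  by apply: integrable_pushforward => //; rewrite preimage_setT.
apply/integrableP; split => //; rewrite (eq_measure_integral push)//.
by move=> A mA _; exact: nu_push.
Qed.

Lemma integrable_pull (f : Y -> R) :
  nu.-integrable setT (fun y => (f y)%:E) ->
  mu.-integrable setT (fun x => (f (phi x))%:E).
Proof.
move=> /integrableP[mfE h]; apply/integrableP; split.
  exact: (measurableT_comp mfE mphi).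
move: h; rewrite (eq_measure_integral push)//; last first.
  by move=> A mA _; exact: nu_push.
by rewrite ge0_integral_pushforward ?preimage_setT//; exact: measurableT_comp.
Qed.

Lemma Rintegral_push (f : Y -> R) : nu.-integrable setT (fun y => (f y)%:E) ->
  \int[nu]_y f y = \int[mu]_x f (phi x).
Proof.
move=> fi; have /measurable_EFinP mf := measurable_int _ fi.
have mfE : measurable_fun setT (EFin \o f) by exact/measurable_EFinP.
rewrite /Rintegral; congr fine; rewrite (eq_measure_integral push)//.
  rewrite integral_pushforward ?preimage_setT//.
  exact: integrable_pull.
by move=> A mA _; exact: nu_push.
Qed.

Lemma L2int_push (f : Y -> R[i]) : cmeasurable_fun f ->
  L2int nu f <-> L2int mu (f \o phi).
Proof.
move=> mf; have mfp := cmeasurable_comp mphi mf; split=> -[_ fi]; split => //.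
  exact: (@integrable_pull (fun y => sqnormc (f y))).
apply: integrable_push => //.
exact: measurable_sqnormc.
Qed.

Lemma norm2_push (f : Y -> R[i]) : L2int nu f -> norm2 nu f = norm2 mu (f \o phi).
Proof. by move=> [_ fi]; exact: (Rintegral_push fi). Qed.

Lemma L2dot_push (f g : Y -> R[i]) : L2int nu f -> L2int nu g ->
  L2dot nu f g = L2dot mu (f \o phi) (g \o phi).
Proof.
move=> fL gL; have [h1 h2] := L2int_cintegrable fL (L2int_conjc gL).
by rewrite /L2dot /cintegral (Rintegral_push h1) (Rintegral_push h2).
Qed.

End change_of_measure.

(** * Dominated convergence and density of indicators in L^2 *)

Section dominated.
Context d (T : measurableType d) (R : realType) (mu : {measure set T -> \bar R}).

(** Dominated convergence applied to the squared moduli. It serves three times: for unions of sets,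
    for simple functions and for trigonometric polynomials. *)
Lemma norm2_cvg0 (h : nat -> T -> R[i]) (G : T -> R) :
  (forall n, cmeasurable_fun (h n)) ->
  mu.-integrable setT (fun x => (G x)%:E) ->
  (forall n x, sqnormc (h n x) <= G x) ->
  {ae mu, forall x, sqnormc (h n x) @[n --> \oo] --> (0 : R)} ->
  norm2 mu (h n) @[n --> \oo] --> (0 : R).
Proof.
move=> mh Gi hG h0.
have [] := @dominated_convergence _ _ _ mu setT measurableT
  (fun n x => (sqnormc (h n x))%:E) (cst 0%E) (fun x => (G x)%:E).
- by move=> n; apply/measurable_EFinP; exact: measurable_sqnormc.
- exact: measurable_cst.
- by apply: filterS h0 => x h0 _; apply: cvg_EFin => //; exact: nearW.
- exact: Gi.
- apply: aeW => x n _; rewrite lee_fin ger0_norm ?sqnormc_ge0//.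
move=> _ _; rewrite integral0 => /fine_cvgP[_]; exact.
Qed.

Lemma cvg0_lt (u : R^nat) (e : R) : u @ \oo --> (0 : R) -> 0 < e ->
  exists n, u n < e.
Proof.
move=> u0 e0; have /cvgrPdist_lt/(_ e e0)[n _ /(_ n (leqnn n))] := u0.
by rewrite sub0r normrN => /(le_lt_trans (ler_norm _)) une; exists n.
Qed.

End dominated.

Section density.
Context d (T : measurableType d) (R : realType) (mu : {measure set T -> \bar R}).
Hypothesis muT : (mu setT < +oo)%E.

Lemma integrable_cst_finite (k : R) : mu.-integrable setT (fun _ => k%:E).
Proof.
apply: (@measurable_bounded_integrable _ _ _ mu (cst k)) => //.
exact: bounded_cst.
Qed.

Definition cindic (A : set T) (x : T) : R[i] := (\1_A x)%:C%C.

Lemma sqnormc_real (a : R) : sqnormc a%:C%C = a ^+ 2.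
Proof. by rewrite /sqnormc/= expr0n/= addr0. Qed.

Lemma cmeasurable_indic (A : set T) : measurable A -> cmeasurable_fun (cindic A).
Proof. by move=> mA; apply: cmeasurable_real; exact: measurable_indic. Qed.

Lemma L2int_bounded (f : T -> R[i]) (M : R) : cmeasurable_fun f ->
  (forall x, sqnormc (f x) <= M) -> L2int mu f.
Proof.
move=> mf fM; split => //; apply: (@integrable_le _ _ _ mu _ (cst M)).
- exact: measurable_sqnormc.
- by move=> x; rewrite ger0_norm ?sqnormc_ge0.
- exact: integrable_cst_finite.
Qed.

Lemma sqnormc_indic_le1 (A : set T) x : sqnormc (cindic A x) <= 1.
Proof. by rewrite sqnormc_real indicE; case: (x \in A); rewrite ?expr1n ?expr0n. Qed.

Lemma L2int_indic (A : set T) : measurable A -> L2int mu (cindic A).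
Proof.
move=> mA; apply: (@L2int_bounded _ 1); first exact: cmeasurable_indic.
exact: sqnormc_indic_le1.
Qed.

Context I (D : set I) (b : I -> T -> R[i]).
Hypothesis bL2 : forall i, D i -> L2int mu (b i).

(** Sets with approximable indicator form a Dynkin system: a complement is a difference of
    indicators, and a disjoint union is the limit of its finite partial unions, with the constant 1
    as dominating function since the mass is finite. *)
Lemma approximable_indic_generated (G : set (set T)) :
  @measurable _ T = <<s G >> -> setI_closed G ->
  approximable mu D b (cindic setT) ->
  (forall A, G A -> approximable mu D b (cindic A)) ->
  forall A, measurable A -> approximable mu D b (cindic A).
Proof.
move=> GE GI aT aG A mA; have : <<s G >> A by rewrite -GE.
move: A {mA}; apply: (dynkin_induction GE GI aT aG).
  move=> A mA aA; have -> : cindic (~` A) = fun x => cindic setT x + (-1) * cindic A x.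
    apply/funext => x; rewrite /cindic !indicE in_setC in_setT.
    by case: (x \in A) => /=; rewrite ?mulr1n ?mulr0n ?mulr0 ?addr0// mulr1 subrr.
  apply: approximableD => //; [exact: L2int_indic|..].
    by apply: L2intZ; exact: L2int_indic.
  by apply: approximableZ => //; exact: L2int_indic.
move=> F mF tF aF.
pose B n := \big[setU/set0]_(k < n) F k.
have mB n : measurable (B n) by exact: bigsetU_measurable.
have mU : measurable (\bigcup_k F k) by exact: bigcupT_measurable.
have aB n : approximable mu D b (cindic (B n)).
  elim: n => [|n IH].
    have -> : cindic (B 0%N) = fun=> 0 :> R[i].
      by apply/funext => x; rewrite /cindic /B big_ord0 indic0.
    exact: approximable0.
  have -> : cindic (B n.+1) = fun x => cindic (B n) x + cindic (F n) x.
    apply/funext => x; rewrite /cindic /B big_ord_recr/= -/(B n).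
    rewrite -rmorphD/=; congr (_%:C)%C.
    rewrite !indicE in_setU; have [xB|xB] := boolP (x \in B n); last by rewrite add0r.
    suff /negbTE -> : x \notin F n by rewrite addr0.
    apply/negP => /set_mem Fnx; move/set_mem : xB.
    rewrite /B -bigcup_mkord => -[k /= kn Fkx].
    have : k = n by apply: (tF k n Logic.I Logic.I); exists x.
    by move/eqP; rewrite (ltn_eqF kn).
  by apply: approximableD => //; exact: L2int_indic.
apply: (approximable_lim bL2) => [|e e0]; first exact: L2int_indic.
have : norm2 mu (fun x => cindic (\bigcup_k F k) x - cindic (B n) x)
    @[n --> \oo] --> (0 : R).
  have E n x : cindic (\bigcup_k F k) x - cindic (B n) x =
      cindic (\bigcup_k F k `\` B n) x.
    rewrite /cindic -rmorphB/=; congr (_%:C)%C; rewrite !indicE in_setD.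
    have [xB|xB] := boolP (x \in B n); last by rewrite subr0 andbT.
    suff -> : x \in \bigcup_k F k by rewrite subrr.
    apply/mem_set; move/set_mem : xB; rewrite /B -bigcup_mkord => -[k _ Fkx].
    by exists k.
  apply: (@norm2_cvg0 _ _ _ mu _ (cst 1)).
  - by move=> n; under eq_fun do rewrite E; apply: cmeasurable_indic; exact: measurableD.
  - exact: integrable_cst_finite.
  - by move=> n x; rewrite E; exact: sqnormc_indic_le1.
  apply: aeW => x.
  have [[k _ Fkx]|nF] := pselect ((\bigcup_k F k) x).
    apply: cvg_near_cst; exists k.+1 => // n /= kn; rewrite E sqnormc_real.
    rewrite indicE memNset ?expr0n//= => -[_]; apply.
    by rewrite /B -bigcup_mkord; exists k.
  apply: cvg_near_cst; apply: nearW => n; rewrite E sqnormc_real.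
  by rewrite indicE memNset ?expr0n//= => -[].
move=> /(cvg0_lt)/(_ e0)[n ne]; exists (cindic (B n)); split => //.
exact: L2int_indic.
Qed.

Import HBNNSimple.

(** The usual ladder: simple functions, nonnegative functions as their monotone limits, real
    functions by positive and negative parts, then complex functions. *)
Lemma approximable_of_indic :
  (forall A, measurable A -> approximable mu D b (cindic A)) ->
  forall f, L2int mu f -> approximable mu D b f.
Proof.
move=> aI.
have sfun (g : {nnsfun T >-> R}) : L2int mu (fun x => (g x)%:C%C) /\
    approximable mu D b (fun x => (g x)%:C%C).
  have gE : (fun x => (g x)%:C%C) = (fun x : T => \sum_(y <- fset_set (range g))
      (y%:C)%C * cindic (g @^-1` [set y]) x).
    apply/funext => x; rewrite fimfunE fsbig_finite//= rmorph_sum/=.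
    by apply: eq_bigr => y _; rewrite rmorphM.
  rewrite gE; elim: (_ (fset_set _)) => [|y s [IHL IHa]].
    under eq_fun do rewrite big_nil.
    by split; [exact: L2int0|exact: approximable0].
  under eq_fun do rewrite big_cons.
  have yL : L2int mu (cindic (g @^-1` [set y])) by exact: L2int_indic.
  split; first by apply: L2intD => //; exact: L2intZ.
  apply: approximableD => //; first exact: L2intZ.
  by apply: approximableZ => //; exact: aI.
have ge0 (f : T -> R) : (forall x, 0 <= f x) -> measurable_fun setT f ->
    L2int mu (fun x => (f x)%:C%C) -> approximable mu D b (fun x => (f x)%:C%C).
  move=> f0 mf fL; apply: (approximable_lim bL2) => // e e0.
  have mfE : measurable_fun setT (EFin \o f) by exact/measurable_EFinP.
  have f0E x : setT x -> (0 <= (EFin \o f) x)%E by move=> _; rewrite lee_fin.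
  pose g := nnsfun_approx measurableT mfE.
  have gf n x : g n x <= f x.
    by rewrite -lee_fin /g nnsfun_approxE; exact: le_approx.
  have : norm2 mu (fun x => (f x)%:C%C - (g n x)%:C%C) @[n --> \oo] --> (0 : R).
    apply: (@norm2_cvg0 _ _ _ mu _ (fun x => sqnormc (f x)%:C%C)).
    - move=> n; under eq_fun do rewrite -rmorphB/=.
      by apply: cmeasurable_real; exact: measurable_funB.
    - by case: fL.
    - move=> n x; rewrite -rmorphB/= !sqnormc_real ler_sqr ?nnegrE ?subr_ge0//.
      by rewrite gerBl.
    - apply: aeW => x; under eq_fun do rewrite -rmorphB/= sqnormc_real.
      have := cvg_nnsfun_approx measurableT mfE f0E (x := x) Logic.I.
      move=> /fine_cvgP[_ /= gx].
      have : (f x - g n x) * (f x - g n x) @[n --> \oo] --> (f x - f x) * (f x - f x).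
        by apply: cvgM; apply: cvgB => //; exact: cvg_cst.
      by rewrite subrr mulr0; under eq_fun do rewrite -expr2.
  move=> /(cvg0_lt)/(_ e0)[n ne].
  by exists (fun x => (g n x)%:C%C); have [? ?] := sfun (g n).
have real (f : T -> R) : measurable_fun setT f ->
    L2int mu (fun x => (f x)%:C%C) -> approximable mu D b (fun x => (f x)%:C%C).
  move=> mf fL.
  (* [s = 1] yields the positive part of [f] and [s = -1] the negative part. *)
  have part (s : R) : s ^+ 2 = 1 ->
     L2int mu (fun x => (Num.max (s * f x) 0)%:C%C) /\
     approximable mu D b (fun x => (Num.max (s * f x) 0)%:C%C).
    move=> s2; have mm : measurable_fun setT (fun x => Num.max (s * f x) 0).
      by apply: measurable_maxr => //; exact: measurable_funM.
    have L : L2int mu (fun x => (Num.max (s * f x) 0)%:C%C).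
      split; first exact: cmeasurable_real.
      apply: (@integrable_le _ _ _ mu _ (fun x => sqnormc (f x)%:C%C)); last by case: fL.
        by apply: measurable_sqnormc; exact: cmeasurable_real.
      move=> x; rewrite ger0_norm ?sqnormc_ge0// !sqnormc_real.
      case: (leP (s * f x) 0) => _; first by rewrite expr0n sqr_ge0.
      by rewrite exprMn s2 mul1r.
    by split => //; apply: ge0 => // x; rewrite le_max lexx orbT.
  have [L1 a1] := part 1 (expr1n _ _).
  have [|L2 a2] := part (-1); first by rewrite sqrrN expr1n.
  have -> : (fun x => (f x)%:C%C) = (fun x => (Num.max (1 * f x) 0)%:C%C +
      (-1) * (Num.max (-1 * f x) 0)%:C%C) :> (T -> R[i]).
    apply/funext => x; rewrite mulN1r -rmorphN -rmorphD/= mul1r mulN1r; congr (_%:C)%C.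
    by case: (leP (f x) 0) => ?; case: (leP (- f x) 0) => ?; lra.
  apply: approximableD => //; first exact: L2intZ.
  exact: approximableZ.
move=> f [[m1 m2] fi].
have L1 : L2int mu (fun x => (complex.Re (f x))%:C%C).
  split; first exact: cmeasurable_real.
  apply: (@integrable_le _ _ _ mu _ (fun x => sqnormc (f x))) => //.
    by apply: measurable_sqnormc; exact: cmeasurable_real.
  by move=> x; rewrite ger0_norm ?sqnormc_ge0// sqnormc_real lerDl sqr_ge0.
have L2 : L2int mu (fun x => (complex.Im (f x))%:C%C).
  split; first exact: cmeasurable_real.
  apply: (@integrable_le _ _ _ mu _ (fun x => sqnormc (f x))) => //.
    by apply: measurable_sqnormc; exact: cmeasurable_real.
  by move=> x; rewrite ger0_norm ?sqnormc_ge0// sqnormc_real lerDr sqr_ge0.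
have -> : f = (fun x => (complex.Re (f x))%:C%C + ('i)%C * (complex.Im (f x))%:C%C).
  apply/funext => x; case: (f x) => p q /=; apply/eqP; rewrite eq_complex/=.
  by apply/andP; split; apply/eqP; ring.
apply: approximableD => //; first exact: L2intZ.
  exact: real.
by apply: approximableZ => //; exact: real.
Qed.

End density.

(** * Lebesgue measure on the unit interval *)

Section unit_interval.
Context (R : realType).

Lemma lebesgue_unit_itv : lebesgue_measure (`[0%R, 1%R] : set R) = 1%E.
Proof. by rewrite lebesgue_measure_itv/= lte_fin ltr01 sube0. Qed.

Lemma lebesgue_unit_itv_lty : (lebesgue_measure (`[0%R, 1%R] : set R) < +oo)%E.
Proof. by rewrite lebesgue_unit_itv ltry. Qed.

(** The measure lives on the whole line, so that integrals run over [setT] and the general L^2 and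
    product lemmas apply as they stand. *)
Definition unit_lebesgue : {finite_measure set (measurableTypeR R) -> \bar R} :=
  @mfrestr _ (measurableTypeR R) R _ lebesgue_measure
    (measurable_itv `[0%R, 1%R]) lebesgue_unit_itv_lty.

Lemma unit_lebesgueT :
  (unit_lebesgue : {measure set (measurableTypeR R) -> \bar R}) setT = 1%E.
Proof. by rewrite /unit_lebesgue/= /mfrestr /mrestr setTI lebesgue_unit_itv. Qed.

Lemma unit_lebesgue_lty :
  ((unit_lebesgue : {measure set (measurableTypeR R) -> \bar R}) setT < +oo)%E.
Proof. by rewrite unit_lebesgueT ltry. Qed.

Lemma unit_lebesgueE (A : set R) : unit_lebesgue A = lebesgue_measure (A `&` `[0%R, 1%R]).
Proof. by []. Qed.

Lemma unit_lebesgue_integral (f : R -> R) :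
  unit_lebesgue.-integrable setT (fun x => (f x)%:E) ->
  (\int[unit_lebesgue]_x (f x)%:E = \int[lebesgue_measure]_(x in `[0%R, 1%R]) (f x)%:E)%E.
Proof.
move=> fi; rewrite (@negligible_integral _ _ _ unit_lebesgue _ (~` `[0%R : R, 1%R]))//.
- rewrite setDE setTI setCK; apply: eq_measure_integral => A mA A01.
  by apply: (etrans (unit_lebesgueE A)); congr lebesgue_measure; exact/setIidPl.
- exact: measurableC.
- by apply: (etrans (unit_lebesgueE _)); rewrite setICl measure0.
Qed.

(** The endpoints form a null set. They must be left out of the limits below because integer
    exponentials take equal values at 0 and 1. *)
Lemma ae_unit_lebesgue (P : R -> Prop) : (forall x, 0 < x < 1 -> P x) ->
  {ae unit_lebesgue, forall x, P x}.
Proof.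
move=> h; exists (~` `]0%R : R, 1%R[); split.
- exact: measurableC.
- apply: (etrans (unit_lebesgueE _)).
  apply: (@subset_measure0 _ _ _ lebesgue_measure _ [set 0%R; 1%R]).
  + by apply: measurableI => //; exact: measurableC.
  + by apply: measurableU.
  + move=> x /= []; rewrite !in_itv/= => /negP.
    rewrite negb_and -!leNgt => /orP[x0|x1] /andP[x0' x1'].
      by left; apply/eqP; rewrite eq_le x0 x0'.
    by right; apply/eqP; rewrite eq_le x1 x1'.
  + by apply: null_set_setU => //; exact: lebesgue_measure_set1.
- move=> x /= nP; rewrite in_itv/= => x01; apply: nP; exact: h.
Qed.

End unit_interval.

(** * Exponentials on the unit interval and their orthogonality *)

Section characters.
Context (R : realType).

Definition cis (a : R) : R[i] := (cos a +i* sin a)%C.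

Lemma cisD a b : cis (a + b) = cis a * cis b.
Proof.
apply/eqP; rewrite eq_complex/= cosD sinD; apply/andP; split; apply/eqP => //.
by rewrite addrC mulrC (mulrC (sin b)) addrC; ring.
Qed.

Lemma cisN a : cis (- a) = (cis a)^*%C.
Proof. by rewrite /cis cosN sinN. Qed.

Lemma cis0 : cis 0 = 1.
Proof. by rewrite /cis cos0 sin0. Qed.

Lemma sqnormc_cis a : sqnormc (cis a) = 1.
Proof. by rewrite /sqnormc/= cos2Dsin2. Qed.

Lemma cis_2pi_int (z : int) : cis (2 * pi * z%:~R) = 1.
Proof.
have nat n : cis (2 * pi * n%:R) = 1.
  elim: n => [|n IH]; first by rewrite mulr0 cis0.
  rewrite -(natr1 n) mulrDr mulr1 cisD IH mul1r /cis.
  by rewrite (mulrC 2) mulr_natr cos2pi sin2pi.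
case: z => n; first exact: nat.
by rewrite NegzE mulrNz mulrN cisN nat conjc1.
Qed.

(** Passing to the fractional part [f], the claim is f = 0. Cosine is injective only on [0, pi],
    which settles f <= 1/2; beyond that, the reflection 1 - f falls in the same range and would have
    to be 0, against f < 1. *)
Lemma cis_2pi_eq1 (s : R) : cis (2 * pi * s) = 1 -> s \is a Num.int.
Proof.
move=> s1; pose f := s - (Num.floor s)%:~R.
have f1 : cos (2 * pi * f) = 1.
  have : cis (2 * pi * f) = 1.
    by rewrite /f mulrBr cisD s1 mul1r cisN cis_2pi_int conjc1.
  by case.
have f0 : 0 <= f by rewrite subr_ge0 ge_floor.
have fl1 : f < 1 by rewrite ltrBlDr addrC -intrD1 lt_succ_floor.
have pi0 := @pi_gt0 R.
suff : f = 0 by move=> /eqP; rewrite subr_eq0 => /eqP ->; exact: intr_int.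
have [fh|fh] := leP f 2^-1.
  have : 2 * pi * f = 0.
    apply: cos_inj; rewrite ?in_itv/= ?lexx ?(ltW pi0) ?f1 ?cos0//.
    by apply/andP; split; nra.
  by move=> /eqP; rewrite !mulf_eq0 pnatr_eq0 (gt_eqF pi0)/= => /eqP.
have g1 : cos (2 * pi * (1 - f)) = 1.
  have : cis (2 * pi * (1 - f)) = cis (2 * pi * - f).
    by rewrite (mulrDr _ 1) cisD (cis_2pi_int 1) mul1r.
  by case=> -> _; rewrite mulrN cosN.
have : 2 * pi * (1 - f) = 0.
  apply: cos_inj; rewrite ?in_itv/= ?lexx ?(ltW pi0) ?g1 ?cos0//.
  by apply/andP; split; nra.
by nra.
Qed.

Lemma measurable_cis : cmeasurable_fun cis.
Proof.
by split; apply: continuous_measurable_fun; [exact: continuous_cos|exact: continuous_sin].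
Qed.

Definition echar (s t : R) : R[i] := cis (2 * pi * (s * t)).

Lemma echarD s s' t : echar (s + s') t = echar s t * echar s' t.
Proof. by rewrite /echar (mulrDl s) (mulrDr (2 * pi)) cisD. Qed.

Lemma echarN s t : echar (- s) t = (echar s t)^*%C.
Proof. by rewrite /echar mulNr mulrN cisN. Qed.

Lemma cmeasurable_echar s : cmeasurable_fun (echar s).
Proof.
apply: (@cmeasurable_comp _ _ _ _ _ (fun t => 2 * pi * (s * t)) cis) => //.
  by apply: measurable_funM => //; exact: measurable_funM.
exact: measurable_cis.
Qed.

Lemma L2int_echar s : L2int (@unit_lebesgue R) (echar s).
Proof.
apply: (L2int_bounded (@unit_lebesgue_lty R) (M := 1)); first exact: cmeasurable_echar.
by move=> t; rewrite sqnormc_cis.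
Qed.

Lemma norm2_echar s : norm2 (@unit_lebesgue R) (echar s) = 1.
Proof.
rewrite /norm2; under eq_Rintegral do rewrite sqnormc_cis.
by rewrite Rintegral_cst// unit_lebesgueT mul1r.
Qed.

Let FTC (F f : R -> R) : (forall x : R, is_derive x 1 F (f x)) ->
  continuous f ->
  (\int[lebesgue_measure]_(x in `[0%R, 1%R]) (f x)%:E = (F 1 - F 0)%:E)%E.
Proof.
move=> dF cf; rewrite EFinB; apply: continuous_FTC2 => //.
- exact: continuous_subspaceT.
- have cF : continuous F.
    by move=> x; apply: differentiable_continuous; apply/derivable1_diffP;
      exact: ex_derive.
  split; [by move=> x _; exact: ex_derive|..].
    exact: cvg_at_right_filter (cF _).
  exact: cvg_at_left_filter (cF _).
- by move=> x _; rewrite derive1E; exact: derive_val.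
Qed.

Lemma cintegral_echar s : s != 0 ->
  let w := 2 * pi * s in
  cintegral (@unit_lebesgue R) (echar s) = (sin w / w +i* ((1 - cos w) / w))%C.
Proof.
move=> s0 w; have w0 : w != 0.
  by rewrite !mulf_neq0// ?pnatr_eq0// gt_eqF// pi_gt0.
(* [echar s] is its own product with [echar 0], and a product of two L^2 functions is integrable. *)
have E t : echar s t * echar 0 t = echar s t by rewrite -echarD addr0.
have {E}[h1 h2] : cintegrable (@unit_lebesgue R) (echar s).
  have := L2int_cintegrable (L2int_echar s) (L2int_echar 0).
  by congr (cintegrable _ _); apply/funext => t; exact: E.
have cw : continuous (fun t : R => w * t) by move=> t; exact: mulrl_continuous.
have dw (x : R) : is_derive x 1 (fun t : R => w * t) w.
  by apply: is_derive_eq; rewrite /GRing.scale/= mulr1.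
have ds (x : R) : is_derive x 1 (fun t : R => sin (w * t) / w) (cos (w * x)).
  by apply: is_derive_eq; rewrite scaler0 add0r /GRing.scale/=; field.
have dc (x : R) : is_derive x 1 (fun t : R => - cos (w * t) / w) (sin (w * x)).
  by apply: is_derive_eq; rewrite scaler0 add0r /GRing.scale/=; field.
have cc : continuous (fun t : R => cos (w * t)).
  by move=> t; apply: continuous_comp; [exact: cw|exact: continuous_cos].
have cs : continuous (fun t : R => sin (w * t)).
  by move=> t; apply: continuous_comp; [exact: cw|exact: continuous_sin].
rewrite /cintegral /Rintegral !unit_lebesgue_integral//; congr (_ +i* _)%C.
  under eq_integral => t _ do rewrite /= mulrA -/w.
  by rewrite (FTC ds cc)/= mulr1 mulr0 sin0 mul0r subr0.
under eq_integral => t _ do rewrite /= mulrA -/w.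
by rewrite (FTC dc cs)/= mulr1 mulr0 cos0 -mulrBl; congr (_ / _); ring.
Qed.

Lemma cintegral_echar0 : cintegral (@unit_lebesgue R) (echar 0) = 1.
Proof.
have E t : echar 0 t = 1 by rewrite /echar mul0r mulr0 cis0.
rewrite (@eq_cintegral _ _ _ _ _ (cst 1))// /cintegral !Rintegral_cst//.
by rewrite unit_lebesgueT/= mulr1 mul0r.
Qed.

(** For nonzero [s], both numerators of [cintegral_echar] vanish exactly when [cis w = 1], that is,
    when [s] is an integer. All orthogonality arguments on product exponentials end here. *)
Lemma cintegral_echar_eq0 s :
  cintegral (@unit_lebesgue R) (echar s) = 0 <-> s \is a Num.int /\ s != 0.
Proof.
have [->|s0] := eqVneq s 0.
  rewrite cintegral_echar0; split; last by case.
  by move/eqP; rewrite oner_eq0.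
rewrite cintegral_echar//; set w := 2 * pi * s.
have w0 : w != 0 by rewrite !mulf_neq0// ?pnatr_eq0// gt_eqF// pi_gt0.
split=> [[/eqP sw /eqP cw]|[/intrP[z zE] _]].
  split => //; apply: cis_2pi_eq1; rewrite -/w /cis; move: sw cw.
  rewrite !mulf_eq0 invr_eq0 (negbTE w0) !orbF => /eqP -> .
  by rewrite subr_eq0 => /eqP <-.
have := cis_2pi_int z; rewrite -zE -/w => -[-> ->].
by rewrite subrr !mul0r.
Qed.


End characters.

(** * Polynomials converging to a step at 1/2 *)

Section bernoulli.
Context (R : realType).
Implicit Types x h : R.

Lemma bernoulli_inequality h n : -1 <= h -> 1 + h *+ n <= (1 + h) ^+ n.
Proof.
move=> h1; elim: n => [|n IH]; first by rewrite mulr0n addr0 expr0.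
have h0 : 0 <= 1 + h by lra.
rewrite exprS mulrSr; apply: (@le_trans _ _ ((1 + h) * (1 + h *+ n))).
  have : 0 <= h * (h *+ n) by rewrite mulrnAr mulrn_wge0// -expr2 sqr_ge0.
  by lra.
by rewrite ler_wpM2l.
Qed.

(** Write x = y^2. Bernoulli applied to 1/y = 1 + h bounds n y^n by 1/h, and the remaining factor
    y^n tends to 0. *)
Lemma cvg_mulrn_expr x : 0 <= x < 1 -> (x ^+ n *+ n) @[n --> \oo] --> (0 : R).
Proof.
move=> /andP[x0 x1]; pose y := Num.sqrt x.
have yx : x = y ^+ 2 by rewrite sqr_sqrtr.
have y0 : 0 <= y by exact: sqrtr_ge0.
have y1 : y < 1 by rewrite -sqrtr1 ltr_sqrt.
have [yE|yN0] := eqVneq y 0.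
  apply: cvg_near_cst; exists 1%N => // -[|n]// _.
  by rewrite yx yE expr0n/= expr0n/= mul0rn.
have yp : 0 < y by rewrite lt_def yN0.
pose h := y^-1 - 1.
have h0 : 0 < h by rewrite subr_gt0 invf_gt1.
have bd n : x ^+ n *+ n <= h^-1 * y ^+ n.
  have hE : 1 + h = y^-1 by rewrite /h addrC subrK.
  have hn : h *+ n <= y^-1 ^+ n.
    rewrite -hE (le_trans _ (bernoulli_inequality _ _)) ?lerDr//; lra.
  have yn : 0 < y ^+ n by rewrite exprn_gt0.
  have h1 : h * (y ^+ n *+ n) <= 1.
    by rewrite mulrnAr -mulrnAl -ler_pdivlMr// mul1r -exprVn.
  rewrite yx -exprM mulnC exprM expr2 -mulrnAl ler_pM2r//.
  by rewrite -[leRHS]mulr1 ler_pdivlMl.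
apply: (@squeeze_cvgr _ _ _ _ (cst 0) (fun n => h^-1 * y ^+ n)).
- by apply: nearW => n; rewrite bd mulrn_wge0// exprn_ge0.
- exact: cvg_cst.
- rewrite -[X in _ --> X](mulr0 h^-1); apply: cvgM; first exact: cvg_cst.
  by apply: cvg_expr; rewrite ger0_norm.
Qed.

(* The exponent [n 2^n], rather than [2^n], makes the limit vanish at [1/2]. *)
Definition step n x := (1 - x ^+ n) ^+ (n * 2 ^ n).

Lemma step_itv n x : 0 <= x <= 1 -> 0 <= step n x <= 1.
Proof.
move=> /andP[x0 x1]; have h0 : 0 <= x ^+ n <= 1 by rewrite exprn_ge0// exprn_ile1.
by rewrite /step exprn_ge0 ?exprn_ile1//; lra.
Qed.

(** Bernoulli bounds [step n x] below by 1 - n (2x)^n, and 2x < 1. *)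
Lemma step_lt x : 0 <= x < 2^-1 -> step n x @[n --> \oo] --> (1 : R).
Proof.
move=> /andP[x0 x1].
apply: (@squeeze_cvgr _ _ _ _ (fun n => 1 - (2 * x) ^+ n *+ n) (cst 1)).
- apply: nearW => n; have /andP[_ ->] : 0 <= step n x <= 1 by apply: step_itv; lra.
  rewrite andbT; have := @bernoulli_inequality (- x ^+ n) (n * 2 ^ n).
  rewrite -/(step n x) => h; apply: le_trans (h _); last first.
    by rewrite lerN2 exprn_ile1//; lra.
  by rewrite mulNrn lerD2l lerN2 exprMn mulnC mulrnA -natrX mulr_natl.
- rewrite -[X in _ --> X](subr0 1); apply: cvgB; first exact: cvg_cst.
  by apply: cvg_mulrn_expr; lra.
- exact: cvg_cst.
Qed.

(** With N = n 2^n, the product of (1 - x^n)^N and (1 + x^n)^N is at most 1, and Bernoulli makes the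
    second factor at least 1 + n (2x)^n >= n + 1. At x = 1/2 it is the factor n of the exponent that
    gives divergence. *)
Lemma step_ge x : 2^-1 <= x <= 1 -> step n x @[n --> \oo] --> (0 : R).
Proof.
move=> /andP[x0 x1]; apply: (@squeeze_cvgr _ _ _ _ (cst 0) (@harmonic R)).
- apply: nearW => n; have /andP[-> _] : 0 <= step n x <= 1 by apply: step_itv; lra.
  have xn0 : 0 <= x ^+ n by rewrite exprn_ge0//; lra.
  have xn1 : x ^+ n <= 1 by rewrite exprn_ile1//; lra.
  have bern : n.+1%:R <= (1 + x ^+ n) ^+ (n * 2 ^ n).
    apply: le_trans (bernoulli_inequality _ _); last by lra.
    rewrite -natr1 addrC lerD2l mulnC mulrnA -(mulr_natl (x ^+ n)).
    rewrite ler_wMn2r// natrX -exprMn exprn_ege1//.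
    by rewrite mulrC -ler_pdivrMr// mul1r.
  rewrite /harmonic/= -[leRHS]mul1r ler_pdivlMr//.
  apply: (@le_trans _ _ (step n x * (1 + x ^+ n) ^+ (n * 2 ^ n))).
    by rewrite ler_wpM2l// /step exprn_ge0//; lra.
  rewrite /step -exprMn exprn_ile1//; nra.
- exact: cvg_cst.
- exact: cvg_harmonic.
Qed.

End bernoulli.

(** * Completeness of the integer exponentials on [0, 1] *)

Section trigonometric_polynomials.
Context (R : realType).
Local Notation ec := (fun z : int => @echar R z%:~R).

(** Kept real-valued so that order bounds and [step] make sense; the complex combination is only a
    witness. *)
Definition trig_poly (q : R -> R) :=
  exists r, (fun t => (q t)%:C%C) = lincomb ec r.

Lemma trig_poly_cst c : trig_poly (cst c).
Proof.
exists [:: (c%:C%C, 0)]; apply/funext => t.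
by rewrite /lincomb big_seq1/= /echar mul0r mulr0 cis0 mulr1.
Qed.

Lemma trig_polyD q q' : trig_poly q -> trig_poly q' ->
  trig_poly (fun t => q t + q' t).
Proof.
move=> [r rE] [s sE]; exists (r ++ s); apply/funext => t.
rewrite /lincomb big_cat/= rmorphD/=.
by congr (_ + _); [exact: (congr1 (@^~ t) rE)|exact: (congr1 (@^~ t) sE)].
Qed.

Lemma trig_polyM q q' : trig_poly q -> trig_poly q' ->
  trig_poly (fun t => q t * q' t).
Proof.
move=> [r rE] [s sE]; exists [seq (p.1 * p'.1, p.2 + p'.2) | p <- r, p' <- s].
apply/funext => t; rewrite /lincomb big_allpairs_dep/= rmorphM/=.
have /= -> := congr1 (@^~ t) rE; have /= -> := congr1 (@^~ t) sE.
rewrite /lincomb mulr_suml; apply: eq_bigr => p _.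
by rewrite mulr_sumr; apply: eq_bigr => p' _; rewrite rmorphD/= echarD; ring.
Qed.

Lemma trig_polyX q n : trig_poly q -> trig_poly (fun t => q t ^+ n).
Proof.
move=> qT; elim: n => [|n IH].
  by under eq_fun do rewrite expr0; exact: trig_poly_cst.
by under eq_fun do rewrite exprS; exact: trig_polyM.
Qed.

Lemma trig_poly_compl q : trig_poly q -> trig_poly (fun t => 1 - q t).
Proof.
move=> qT; have -> : (fun t => 1 - q t) = fun t => 1 + (-1) * q t.
  by apply/funext => t; rewrite mulN1r.
apply: trig_polyD; first exact: trig_poly_cst.
by apply: trig_polyM => //; exact: trig_poly_cst.
Qed.

Lemma trig_poly_sin a : trig_poly (fun t => sin (2 * pi * (t - a))).
Proof.
(* From sin y = (e^(iy) - e^(-iy)) / (2i): the first factor is 1 / (2i), and the second term of the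
   formula is the conjugate of the first. *)
pose c := (0 +i* (- 2^-1))%C * cis (- (2 * pi * a)).
exists [:: (c, 1); (c^*%C, -1)]; apply/funext => t.
rewrite /lincomb big_cons big_seq1/= -[echar _ t]/(echar 1 t).
have -> : echar (-1)%:~R t = (echar 1 t)^*%C by rewrite -echarN.
have -> : c * echar 1 t = (0 +i* (- 2^-1))%C * cis (2 * pi * (t - a)).
  by rewrite /c -[LHS]mulrA /echar -cisD; congr (_ * cis _); ring.
have -> : c^*%C * (echar 1 t)^*%C =
    ((0 +i* (- 2^-1))%C * cis (2 * pi * (t - a)))^*%C.
  rewrite -rmorphM; congr (_^*)%C.
  by rewrite /c -[LHS]mulrA /echar -cisD; congr (_ * cis _); ring.
apply/eqP; rewrite eq_complex ReD ImD Re_conjc Im_conjc ReM ImM/=.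
by apply/andP; split; apply/eqP; field.
Qed.

(** Values in [0, 1] are preserved by complements and products, and they supply the dominating
    function. Convergence is asked only in ]0, 1[, as an indicator need not agree at 0 and 1. *)
Definition trig_limit (A : set R) := exists q : nat -> R -> R,
  [/\ forall n, trig_poly (q n), forall n t, 0 <= q n t <= 1 &
      forall t, 0 < t < 1 -> q n t @[n --> \oo] --> (\1_A t : R)].

Lemma trig_limit_ext A B : (forall t, 0 < t < 1 -> A t <-> B t) ->
  trig_limit A -> trig_limit B.
Proof.
move=> AB [q [qT q01 qA]]; exists q; split => // t t01.
suff -> : \1_B t = \1_A t :> R by exact: qA.
rewrite !indicE; congr ((nat_of_bool _)%:R).
by apply/idP/idP; rewrite !inE => /(AB t t01).
Qed.

Lemma trig_limitC A : trig_limit A -> trig_limit (~` A).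
Proof.
move=> [q [qT q01 qA]]; exists (fun n t => 1 - q n t); split.
- by move=> n; exact: trig_poly_compl.
- by move=> n t; have := q01 n t; lra.
- move=> t t01; have -> : \1_(~` A) t = 1 - \1_A t :> R.
    by rewrite !indicE in_setC; case: (t \in A); rewrite /= ?subrr ?subr0.
  by apply: cvgB; [exact: cvg_cst|exact: qA].
Qed.

Lemma trig_limitI A B : trig_limit A -> trig_limit B -> trig_limit (A `&` B).
Proof.
move=> [q [qT q01 qA]] [q' [qT' q01' qA']].
exists (fun n t => q n t * q' n t); split.
- by move=> n; exact: trig_polyM.
- by move=> n t; have := q01 n t; have := q01' n t; nra.
- by move=> t t01; rewrite indicI; apply: cvgM; [exact: qA|exact: qA'].
Qed.

Lemma trig_limitU A B : trig_limit A -> trig_limit B -> trig_limit (A `|` B).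
Proof.
move=> hA hB; rewrite -[_ `|` _]setCK setCU; apply: trig_limitC.
by apply: trig_limitI; exact: trig_limitC.
Qed.

(** The map s -> (1 - s)/2 takes [-1, 1] to [0, 1] and s > 0 to values below 1/2, so composing it
    with [step] separates the two half circles. A zero of the sine goes to 1/2, where the limit of
    [step] is 0, as the strict inequality requires. *)
Lemma trig_limit_half a : trig_limit [set t | 0 < sin (2 * pi * (t - a))].
Proof.
exists (fun n t => step n ((1 - sin (2 * pi * (t - a))) * 2^-1)).
have sin1 (t : R) : -1 <= sin t <= 1 by rewrite sin_geN1 sin_le1.
split.
- move=> n; rewrite /step; apply: trig_polyX; apply: trig_poly_compl.
  apply: trig_polyX; apply: trig_polyM; last exact: trig_poly_cst.
  by apply: trig_poly_compl; exact: trig_poly_sin.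
- by move=> n t; apply: step_itv; have := sin1 (2 * pi * (t - a)); lra.
- move=> t _; have := sin1 (2 * pi * (t - a)).
  set s := sin _ => s1; rewrite indicE; have [s0|s0] := ltP 0 s.
    by rewrite mem_set//=; apply: step_lt; lra.
  rewrite memNset/=; last by apply/negP; rewrite -leNgt.
  by apply: step_ge; lra.
Qed.

Lemma sin_2pi_gt0 (u : R) : 0 < u < 2^-1 -> 0 < sin (2 * pi * u).
Proof.
move=> u0; apply: sin_gt0_pi; have pi0 := @pi_gt0 R.
by apply/andP; split; nra.
Qed.

Lemma sin_2pi_lt0 (u : R) : - 2^-1 < u < 0 -> sin (2 * pi * u) < 0.
Proof.
move=> u0; rewrite -oppr_gt0 -sinN -mulrN; apply: sin_2pi_gt0; lra.
Qed.

Lemma sin_2pi_int (u : R) (z : int) : sin (2 * pi * (u + z%:~R)) = sin (2 * pi * u).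
Proof.
have : cis (2 * pi * (u + z%:~R)) = cis (2 * pi * u).
  by rewrite (mulrDr _ u) cisD cis_2pi_int mulr1.
by case.
Qed.

(* On ]0, 1[, the interval ]0, a[ is the intersection (a <= 1/2) or the union
   (1/2 <= a) of the half circles ]0, 1/2[ and ]a - 1/2, a[. *)
Lemma trig_limit_ray a : trig_limit `]-oo, a[%classic.
Proof.
have hT : trig_limit setT.
  exists (fun _ => cst 1); split => [n|n t|t _]; first exact: trig_poly_cst.
    by rewrite ler01 lexx.
  by rewrite indicT; exact: cvg_cst.
have [a0|a0] := leP a 0.
  apply: trig_limit_ext (trig_limitC hT) => t /andP[t0 t1].
  by rewrite setCT /= in_itv/=; split => // ta; lra.
have [a1|a1] := leP 1 a.
  apply: trig_limit_ext hT => t /andP[t0 t1].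
  by rewrite /= in_itv/=; split => // _; lra.
have h1 (t : R) : 0 < t < 1 -> t < 2^-1 -> 0 < sin (2 * pi * (t - 0)).
  by move=> t01 th; apply: sin_2pi_gt0; lra.
have h1' (t : R) : 0 < t < 1 -> 2^-1 <= t -> sin (2 * pi * (t - 0)) <= 0.
  move=> t01; rewrite le_eqVlt => /predU1P[<-|th].
    by rewrite subr0 mulrAC divff ?pnatr_eq0// mul1r sinpi.
  by apply/ltW; rewrite -(sin_2pi_int _ (-1)); apply: sin_2pi_lt0; lra.
have hlf : trig_limit [set t | 0 < sin (2 * pi * (t - 0))] by exact: trig_limit_half.
have hla : trig_limit [set t | 0 < sin (2 * pi * (t - (a - 2^-1)))].
  by exact: trig_limit_half.
have [ah|ah] := leP a 2^-1.
  apply: trig_limit_ext (trig_limitI hlf hla) => t t01 /=; rewrite in_itv/=.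
  split=> [[s0 sa]|ta].
    rewrite ltNge; apply/negP => at_; have th : t < 2^-1.
      by rewrite ltNge; apply/negP => /(h1' _ t01); rewrite leNgt s0.
    (* At t = a the argument of the sine is pi, so the sine is 0; for t > a, removing one period
       puts the argument in ]-pi, 0[, where the sine is negative. *)
    have [eat|nat] := eqVneq a t.
      move: sa; rewrite eat opprB addrC subrK mulrAC divff ?pnatr_eq0// mul1r.
      by rewrite sinpi ltxx.
    have {}at_ : a < t by rewrite lt_def at_ eq_sym nat.
    have := @sin_2pi_lt0 (t - (a - 2^-1) - 1); rewrite -(sin_2pi_int _ 1) subrK.
    by move=> h; have := h ltac:(lra); lra.
  by split; [apply: h1 => //; lra|apply: sin_2pi_gt0; lra].
apply: trig_limit_ext (trig_limitU hlf hla) => t t01 /=; rewrite in_itv/=.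
split=> [[s0|sa]|ta].
- have th : t < 2^-1.
    by rewrite ltNge; apply/negP => /(h1' _ t01); rewrite leNgt s0.
  lra.
- rewrite ltNge; apply/negP => at_.
  have [eat|nat] := eqVneq a t.
    move: sa; rewrite eat opprB addrC subrK mulrAC divff ?pnatr_eq0// mul1r.
    by rewrite sinpi ltxx.
  have {}at_ : a < t by rewrite lt_def at_ eq_sym nat.
  have := @sin_2pi_lt0 (t - (a - 2^-1) - 1); rewrite -(sin_2pi_int _ 1) subrK.
  by move=> h; have := h ltac:(lra); lra.
- have [th|th] := ltP t 2^-1; first by left; exact: h1.
  by right; apply: sin_2pi_gt0; lra.
Qed.

Lemma approximable_trig_limit (A : set (measurableTypeR R)) :
  measurable A -> trig_limit A ->
  approximable (@unit_lebesgue R) setT ec (cindic R A).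
Proof.
move=> mA [q [qT q01 qA]]; have ecL z : setT z -> L2int (@unit_lebesgue R) (ec z).
  by move=> _; exact: L2int_echar.
have qr n : exists r, (fun t => (q n t)%:C%C) = lincomb ec r by exact: qT.
have rT (r : seq (R[i] * int)) : coefs_in [set: int] r.
  by elim: r => //= p r ->; rewrite andbT; exact/asboolP.
have qL n : L2int (@unit_lebesgue R) (fun t => (q n t)%:C%C).
  by have [r ->] := qr n; exact: (lincomb_L2 ecL (rT r)).
have AL := L2int_indic (@unit_lebesgue_lty R) mA.
apply: (approximable_lim ecL) => // e e0.
have : norm2 (@unit_lebesgue R) (fun x => cindic R A x - (q n x)%:C%C)
    @[n --> \oo] --> (0 : R).
  apply: (@norm2_cvg0 _ _ _ (@unit_lebesgue R) _ (cst 1)).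
  - by move=> n; have [] := L2intB AL (qL n).
  - exact: integrable_cst_finite (@unit_lebesgue_lty R) _.
  - move=> n x; rewrite -rmorphB/= sqnormc_real indicE.
    by have := q01 n x; case: (x \in A) => /= /andP[? ?]; nra.
  - apply: ae_unit_lebesgue => x x01.
    under eq_fun do rewrite -rmorphB/= sqnormc_real expr2.
    have : (\1_A x - q n x) * (\1_A x - q n x) @[n --> \oo] -->
        ((\1_A x - \1_A x) * (\1_A x - \1_A x) : R).
      by apply: cvgM; apply: cvgB => //; by [exact: cvg_cst|exact: qA].
    by rewrite subrr mulr0.
move=> /(cvg0_lt)/(_ e0)[n ne]; exists (fun x => (q n x)%:C%C); split => //.
by have [r ->] := qr n; exact: (approximable_lincomb _ _ (rT r)).
Qed.

(** Left rays generate the Borel sets and are stable under intersection, so density reduces to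
    [trig_limit_ray]. *)
Lemma echar_complete (f : R -> R[i]) : L2int (@unit_lebesgue R) f ->
  approximable (@unit_lebesgue R) setT ec f.
Proof.
have ecL z : setT z -> L2int (@unit_lebesgue R) (ec z).
  by move=> _; exact: L2int_echar.
apply: (approximable_of_indic (@unit_lebesgue_lty R) ecL) => // A mA.
apply: (approximable_indic_generated (@unit_lebesgue_lty R) ecL
  (RGenInftyO.measurableE R)) => //.
- move=> _ _ [x ->] [y ->]; exists (Num.min x y).
  by apply/seteqP; split => t /=; rewrite !in_itv/= lt_min => /andP.
- apply: approximable_trig_limit => //.
  have : trig_limit `]-oo, 1%R[%classic by exact: trig_limit_ray.
  apply: trig_limit_ext => t /andP[t0 t1]; rewrite /= in_itv/=; split => //.
- by move=> _ [x ->]; apply: approximable_trig_limit => //; exact: trig_limit_ray.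
Qed.

End trigonometric_polynomials.

(** * Exponentials on R^n and a single product with the interval *)

Section expchar.
Context (R : realType) (n : nat).
Implicit Types l x : 'rV[R]_n.

Lemma expcharE l x : expchar l x = cis (2 * pi * dotprod l x).
Proof. by []. Qed.

Lemma cmeasurable_expchar l : cmeasurable_fun (expchar l).
Proof.
apply: (@cmeasurable_comp _ _ _ _ _ (fun x => 2 * pi * dotprod l x) (@cis R)).
  apply: measurable_funM => //; apply: measurable_sum => i.
  by apply: measurable_funM => //; exact: measurable_coord.
exact: measurable_cis.
Qed.

Lemma L2int_expchar (mu : {measure set 'rV[R]_n -> \bar R}) l :
  (mu setT < +oo)%E -> L2int mu (expchar l).
Proof.
move=> muT; apply: (L2int_bounded muT (M := 1)); first exact: cmeasurable_expchar.
by move=> x; rewrite expcharE sqnormc_cis.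
Qed.

Lemma norm2_expchar (mu : {measure set 'rV[R]_n -> \bar R}) l :
  norm2 mu (expchar l) = fine (mu setT).
Proof.
rewrite /norm2; under eq_Rintegral do rewrite expcharE sqnormc_cis.
by rewrite Rintegral_cst// mul1r.
Qed.

End expchar.

Lemma L2dot_echar (R : realType) (s s' : R) :
  L2dot (@unit_lebesgue R) (echar s) (echar s') =
  cintegral (@unit_lebesgue R) (echar (s - s')).
Proof. by apply: eq_cintegral => t; rewrite echarD echarN. Qed.

Section cylinder.
Context (R : realType) (n : nat) (rho : {finite_measure set 'rV[R]_n -> \bar R}).

(** What remains of an orthogonal basis for exponentials: their squared norm is the total mass, so
    nonvanishing is a condition on the measure alone. *)
Definition complete_orthogonal d (T : measurableType d)
    (mu : {measure set T -> \bar R}) I (D : set I) (b : I -> T -> R[i]) :=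
  (forall i j, D i -> D j -> i <> j -> L2dot mu (b i) (b j) = 0) /\
  (forall f, L2int mu f -> approximable mu D b f).

Local Notation U := (@unit_lebesgue R).
Local Notation pi_ := (rho \x U)%E.

Definition pchar (p : 'rV[R]_n * R) (z : 'rV[R]_n * measurableTypeR R) : R[i] :=
  expchar p.1 z.1 * echar p.2 z.2.

Let rhoT : (rho setT < +oo)%E.
Proof. by rewrite -ge0_fin_numE// fin_num_measure. Qed.

Let piT : (pi_ setT < +oo)%E.
Proof.
have -> : pi_ setT = (rho setT * U setT)%E.
  by rewrite -setXTT product_measure1E.
by rewrite unit_lebesgueT mule1.
Qed.

Let eL l : L2int rho (expchar l).
Proof. exact: L2int_expchar. Qed.

Let sL s : L2int U (echar s).
Proof. exact: L2int_echar. Qed.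

Let pL p : L2int pi_ (pchar p).
Proof. exact: L2int_tensor. Qed.

(** When the left side is 0 one factor is 0, and [cintegral_echar_eq0] decides whether it can be the
    second. *)
Lemma L2dot_pchar p q : L2dot pi_ (pchar p) (pchar q) =
  L2dot rho (expchar p.1) (expchar q.1) * cintegral U (echar (p.2 - q.2)).
Proof. by rewrite /pchar L2dot_tensor// L2dot_echar. Qed.

(** Two distinct frequencies differ in [l], where [rho] separates them, or in the integer, where the
    interval does. For completeness, the indicator of a rectangle is a tensor, and rectangles are
    stable under intersection and generate the product sigma-algebra. *)
Lemma spectrum_cylinder (L : set 'rV[R]_n) :
  complete_orthogonal rho L (@expchar R n) ->
  complete_orthogonal pi_ (L `*` range (fun z : int => z%:~R)) pchar.
Proof.
move=> [orth cpl]; split.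
  move=> [l s] [l' s'] [/= Ll [z _ zs]] [/= Ll' [z' _ zs']] ne.
  rewrite L2dot_pchar/=; have [ll|ll] := pselect (l = l'); last first.
    by rewrite orth// mul0r.
  have ss : s != s' by apply/eqP => ss; apply: ne; rewrite ll ss.
  rewrite [X in _ * X](_ : _ = 0) ?mulr0//; apply/cintegral_echar_eq0.
  by rewrite subr_eq0; split => //; rewrite -zs -zs' -intrB intr_int.
pose D' := range (fun z : int => z%:~R : R).
have pL' i : (L `*` D') i -> L2int pi_ (pchar i) by [].
apply: (approximable_of_indic piT pL').
have tens (f : 'rV[R]_n -> R[i]) (g : measurableTypeR R -> R[i]) :
    L2int rho f -> L2int U g ->
    approximable pi_ (L `*` D') pchar (fun z => f z.1 * g z.2).
  move=> fL gL; apply: approximable_tensor => //; first exact: cpl.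
  apply: approximable_reindex (echar_complete gL) => [z _|z _].
    by exists z.
  by [].
pose G := [set A `*` B | A in @measurable _ 'rV[R]_n &
  B in @measurable _ (measurableTypeR R)].
have GE : @measurable _ ('rV[R]_n * measurableTypeR R)%type = <<s G >>.
  by rewrite measurable_prod_measurableType.
have GI : setI_closed G.
  move=> _ _ [A mA [B mB <-]] [A' mA' [B' mB' <-]].
  exists (A `&` A'); first exact: measurableI.
  by exists (B `&` B'); [exact: measurableI|rewrite setXI].
have rect A B : measurable A -> measurable B ->
    approximable pi_ (L `*` D') pchar (cindic R (A `*` B)).
  move=> mA mB.
  have -> : cindic R (A `*` B) = fun z => cindic R A z.1 * cindic R B z.2.
    apply/funext => z; rewrite /cindic -rmorphM/= !indicE -natrM mulnb.
    by congr ((nat_of_bool _)%:R%:C)%C; apply/idP/andP; rewrite !inE.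
  apply: tens; first exact: (L2int_indic rhoT mA).
  exact: (L2int_indic (@unit_lebesgue_lty R) mB).
move=> A mA; apply: (approximable_indic_generated piT pL' GE GI) => //.
  by have := rect setT setT measurableT measurableT; rewrite setXTT.
by move=> _ [A' mA' [B' mB' <-]]; exact: rect.
Qed.

Let int_floor (s : R) := (Num.floor s)%:~R : R.

Let floorp (p : 'rV[R]_n * R) := (p.1, int_floor p.2).

(* Shifting the second frequencies of a class modulo the integers does not
   change the closed span of that class: it stays orthogonal to the other
   classes, which are complementary to the class itself. *)
Let floorp_complete (L : set ('rV[R]_n * R)) p : L p ->
  complete_orthogonal pi_ L pchar ->
  approximable pi_ L (pchar \o floorp) (pchar p).
Proof.
case: p => l s Lp [orth cpl]; pose u := s - int_floor s.
pose P := [set q : 'rV[R]_n * R | q.2 - s \is a Num.int].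
have rho_orth l' s' : L (l', s') -> ~ P (l', s') ->
    L2dot rho (expchar l) (expchar l') = 0.
  move=> Lq nP; have ne : (l, s) <> (l', s').
    by move=> -[_ ss]; apply: nP; rewrite /P/= ss subrr int_num0.
  have := orth _ _ Lp Lq ne; rewrite L2dot_pchar/= => /eqP.
  rewrite mulf_eq0 => /orP[/eqP//|/eqP/cintegral_echar_eq0[si _]].
  by exfalso; apply: nP; rewrite /P/= -opprB rpredN.
(* The frequency is moved up by [u] because the approximation is then multiplied by e_(-u): this
   returns [s + u] to [s] and takes every frequency of the class to its integer part. *)
have := @approximable_drop _ _ _ pi_ _ L P pchar (pchar (l, s + u))
  (fun q _ => pL q) (pL _) (cpl _ (pL _)) _ _.
have -> : pchar (l, s) = fun z => echar (- u) z.2 * pchar (l, s + u) z.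
  apply/funext => z; rewrite /pchar/= mulrCA -echarD; congr (_ * echar _ _); ring.
move=> h e e0; case: (h _ _ e e0) => {h}.
- move=> [l' s'] Lq nP; by rewrite L2dot_pchar/= (rho_orth _ _ Lq nP) mul0r.
- by move=> i j Li Lj Pi nPj; apply: orth => // ij; apply: nPj; rewrite -ij.
move=> r Dr re; exists r.
  by apply: sub_all Dr => q /asboolP[Lq _]; exact/asboolP.
have rE z : lincomb (pchar \o floorp) r z = echar (- u) z.2 * lincomb pchar r z.
  rewrite /lincomb; elim: r Dr {re} => [|q r IH]/=; first by rewrite !big_nil mulr0.
  move=> /andP[/asboolP[_ Pq] /IH E]; rewrite !big_cons E mulrDr; congr (_ + _).
  rewrite /pchar/=.
  (* All frequencies of the class share the fractional part [u] of [s]. *)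
  have -> : int_floor q.2.2 = - u + q.2.2.
    have [z' zE] := intrP Pq; rewrite /u /int_floor.
    have -> : q.2.2 = s + z'%:~R by rewrite -zE addrC subrK.
    by rewrite floorDrz ?intr_int// intrKfloor rmorphD/=; ring.
  by rewrite echarD; ring.
congr (_ < e): re; apply: eq_Rintegral => z _ /=.
by rewrite rE -mulrBr sqnormcM sqnormc_cis mul1r.
Qed.

(** Second frequencies with integer part 0 lie in [0, 1[, so their difference is never a nonzero
    integer and orthogonality has to come from [rho]. Completeness is tested on functions constant
    in the second variable. *)
Lemma spectrum_base (L : set ('rV[R]_n * R)) :
  complete_orthogonal pi_ L pchar ->
  complete_orthogonal rho [set l | exists2 s, L (l, s) & Num.floor s = 0]
    (@expchar R n).
Proof.
move=> co; have [orth cpl] := co; split.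
  move=> l l' [s Ls s0] [s' Ls' s0'] ne.
  have := orth _ _ Ls Ls'; rewrite L2dot_pchar/= => h.
  have {}h := h (fun E => ne (congr1 fst E)).
  move/eqP : h; rewrite mulf_eq0 => /orP[/eqP//|/eqP/cintegral_echar_eq0[si]].
  rewrite subr_eq0 => ss; exfalso.
  have := floor_itv s; have := floor_itv s'; rewrite s0 s0' add0r mulr0z mulr1z => b b'.
  have /intrP[z zE] := si.
  have : ((-1)%:~R : R) < z%:~R < (1%:~R : R) by rewrite -zE mulrN1z mulr1z; lra.
  rewrite !ltr_int => /andP[z1 z2].
  have z0 : z = 0 by lia.
  by move: ss; rewrite -subr_eq0 zE z0 eqxx.
move=> f fL; pose F z := f z.1 * echar 0 z.2.
have FL : L2int pi_ F by exact: L2int_tensor.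
pose b' l (z : 'rV[R]_n * measurableTypeR R) := expchar l z.1 * echar 0 z.2.
have echar0_floor (s : R) : Num.floor s <> 0 ->
    L2dot U (echar 0) (echar (int_floor s)) = 0.
  move=> s0; rewrite L2dot_echar; apply/cintegral_echar_eq0.
  rewrite sub0r rpredN intr_int oppr_eq0 intr_eq0; split => //; exact/eqP.
have FA : approximable pi_ L (pchar \o floorp) F.
  apply: (approximable_trans (fun p _ => pL p) (fun p _ => pL (floorp p)) FL
    (cpl _ FL)) => p Lp.
  exact: floorp_complete.
pose Q := [set q : 'rV[R]_n * R | Num.floor q.2 = 0].
have {}FA : approximable pi_ (L `&` Q) (pchar \o floorp) F.
  (* The shifted family need not be known to be orthogonal: it is enough that exponentials of
     nonzero integer part are orthogonal, already in the second variable, to [F] and to those of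
     integer part 0. *)
  apply: (approximable_drop (fun p _ => pL (floorp p)) FL FA)
    => [q Lq nQ|p q Lp Lq Qp nQ].
    by rewrite L2dot_tensor// echar0_floor ?mulr0.
  have p0 : int_floor p.2 = 0 by rewrite /int_floor Qp.
  by rewrite /= L2dot_pchar/= -L2dot_echar p0 echar0_floor ?mulr0.
have {FA} : approximable pi_ [set l | exists2 s, L (l, s) & Num.floor s = 0] b' F.
  apply: (@approximable_reindex _ _ _ _ _ _ _ _ _ _ fst) FA
    => [[l s] [Ls Qs]|[l s] [Ls Qs]].
    by exists s.
  by apply/funext => z; rewrite /pchar /b'/= /int_floor Qs.
move=> h e /h[r Dr re]; exists r => //; congr (_ < e): re.
have rL : L2int rho (lincomb (@expchar R n) r) by apply: lincomb_L2 Dr.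
(* The whole error is a tensor with [echar 0], of norm 1, so its squared norm equals that of the
   error in [rho]. *)
have -> : (fun z => F z - lincomb b' r z) =
    (fun z => (f z.1 - lincomb (@expchar R n) r z.1) * echar 0 z.2).
  apply/funext => z; rewrite mulrBl; congr (_ - _).
  by rewrite /lincomb mulr_suml; apply: eq_bigr => p _; rewrite mulrA.
by rewrite (norm2_tensor (L2intB fL rL) (sL 0)) norm2_echar mulr1.
Qed.

End cylinder.

(** * From the product to row vectors with one more coordinate *)

Section transfer_approximable.
Context d d' (X : measurableType d) (Y : measurableType d') (R : realType).
Variables (phi : X -> Y) (mphi : measurable_fun setT phi).
Variables (mu : {measure set X -> \bar R}) (nu : {measure set Y -> \bar R}).
Hypothesis nuE : forall A, measurable A -> nu A = mu (phi @^-1` A).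

Lemma approximable_push I (D : set I) (b : I -> Y -> R[i]) f :
  (forall i, D i -> L2int nu (b i)) -> L2int nu f ->
  approximable nu D b f <->
  approximable mu D (fun i => b i \o phi) (f \o phi).
Proof.
move=> bL fL; split=> fa e /fa[r Dr re]; exists r => //; move: re;
  have rL := lincomb_L2 bL Dr.
  by rewrite (norm2_push mphi nuE (L2intB fL rL)).
by rewrite (norm2_push mphi nuE (L2intB fL rL)).
Qed.

End transfer_approximable.

Section coordinates.
Context (R : realType) (n : nat).

Definition uncons_rV (x : 'rV[R]_n.+1) : 'rV[R]_n * R :=
  (\row_i x 0 (lift ord0 i), x 0 ord0).

Lemma cons_rV_ord0 (p : 'rV[R]_n * R) : cons_rV p 0 ord0 = p.2.
Proof.
have -> : ord0 = lshift n (ord0 : 'I_1) :> 'I_(1 + n) by apply/val_inj.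
by rewrite /cons_rV (@row_mxEl _ 1 1 n) mxE mulr1n.
Qed.

Lemma cons_rV_lift (p : 'rV[R]_n * R) i : cons_rV p 0 (lift ord0 i) = p.1 0 i.
Proof.
have -> : lift ord0 i = rshift 1 i :> 'I_(1 + n) by apply/val_inj.
by rewrite /cons_rV (@row_mxEr _ 1 1 n).
Qed.

Lemma cons_rVK : cancel (@cons_rV R n) uncons_rV.
Proof.
move=> [x t]; rewrite /uncons_rV cons_rV_ord0; congr (_, _).
by apply/rowP => i; rewrite mxE cons_rV_lift.
Qed.

Lemma uncons_rVK : cancel uncons_rV (@cons_rV R n).
Proof.
move=> x; apply/rowP => i; case: (unliftP ord0 i) => [j|] ->.
  by rewrite cons_rV_lift mxE.
by rewrite cons_rV_ord0.
Qed.

Lemma measurable_uncons_rV :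
  measurable_fun setT (uncons_rV : _ -> 'rV[R]_n * measurableTypeR R).
Proof.
apply/measurable_fun_pairP; split; last exact: measurable_coord.
apply/measurable_fun_mxP => i j; rewrite /uncons_rV/=.
by under eq_fun do rewrite mxE; exact: measurable_coord.
Qed.

Lemma expchar_cons (p z : 'rV[R]_n * R) :
  expchar (cons_rV p) (cons_rV z) = pchar p z.
Proof.
rewrite /pchar !expcharE /echar -cisD; congr cis.
rewrite /dotprod big_ord_recl !cons_rV_ord0 addrC mulrDr; congr (_ * _ + _).
by apply: eq_bigr => i _; rewrite !cons_rV_lift.
Qed.

End coordinates.

Section cylinder_rV.
Context (R : realType) (n : nat).
Local Notation U := (@unit_lebesgue R).

Definition cylinder_rV (rho : set 'rV[R]_n -> \bar R) : set 'rV[R]_n.+1 -> \bar R :=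
  pushforward (rho \x U)%E (@cons_rV R n).

Section measure.
Context (rho : {finite_measure set 'rV[R]_n -> \bar R}).

Let pm : {measure set 'rV[R]_n.+1 -> \bar R} :=
  measure_function_pushforward__canonical__measure_function_Measure
    (rho \x U)%E (@measurable_cons_rV R n).

HB.instance Definition _ := isMeasure.Build _ _ _ (cylinder_rV rho)
  (measure0 pm) (measure_ge0 pm) (@measure_semi_sigma_additive _ _ _ pm).

Lemma cylinder_rVT : cylinder_rV rho setT = rho setT.
Proof.
rewrite /cylinder_rV /pushforward preimage_setT -setXTT product_measure1E//.
by rewrite unit_lebesgueT mule1.
Qed.

Let finite : fin_num_fun (cylinder_rV rho).
Proof.
move=> A mA; rewrite ge0_fin_numE ?measure_ge0//.
apply: (@le_lt_trans _ _ (cylinder_rV rho setT)).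
  by apply: le_measure; rewrite ?inE.
by rewrite cylinder_rVT -ge0_fin_numE// fin_num_measure.
Qed.

HB.instance Definition _ := Measure_isFinite.Build _ _ _ (cylinder_rV rho) finite.

End measure.

(** Nonzero mass is what makes every exponential a nonzero vector, as a basis in [spectral_measure]
    demands. *)
Lemma spectral_measureP k (mu : {finite_measure set 'rV[R]_k -> \bar R}) :
  mu setT <> 0%E ->
  spectral_measure mu <->
  exists2 L, countable L & complete_orthogonal mu L (@expchar R k).
Proof.
move=> mu0; have muT : (mu setT < +oo)%E by rewrite -ge0_fin_numE// fin_num_measure.
have eL (L : set 'rV[R]_k) l : L l -> L2int mu (expchar l).
  by move=> _; exact: L2int_expchar.
have e0 (L : set 'rV[R]_k) l : L l -> norm2 mu (expchar l) <> 0.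
  move=> _; rewrite norm2_expchar => m0; apply: mu0.
  by rewrite -(@fineK _ (mu setT)) ?m0// fin_num_measure.
split=> [[_ [L [cL /(basisP (eL L) (e0 L)) h]]]|[L cL h]]; first by exists L.
by split => //; exists L; split => //; apply/(basisP (eL L) (e0 L)).
Qed.

(** [cons_rV] is a bijection measurable in both directions, so every L^2 function on the product
    comes from one on R^(n+1); by [expchar_cons] the same map relabels the frequencies. *)
Lemma complete_orthogonal_cons (rho : {finite_measure set 'rV[R]_n -> \bar R}) L :
  complete_orthogonal (cylinder_rV rho) L (@expchar R n.+1) <->
  complete_orthogonal (rho \x U)%E (@cons_rV R n @^-1` L) (@pchar R n).
Proof.
have tauE A : measurable A -> cylinder_rV rho A =
    (rho \x U)%E (@cons_rV R n @^-1` A) by [].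
have mcons : measurable_fun setT (@cons_rV R n : 'rV[R]_n * measurableTypeR R -> _).
  exact: measurable_cons_rV.
have eL l : L2int (cylinder_rV rho) (expchar l).
  by apply: L2int_expchar; rewrite -ge0_fin_numE// fin_num_measure.
have pE p : expchar (cons_rV p) \o @cons_rV R n = pchar p.
  by apply/funext => z; exact: expchar_cons.
have dotE p q : L2dot (rho \x U)%E (pchar p) (pchar q) =
    L2dot (cylinder_rV rho) (expchar (cons_rV p)) (expchar (cons_rV q)).
  by rewrite (L2dot_push mcons tauE (eL _) (eL _)) !pE.
split=> -[orth cpl]; split.
- move=> p q Lp Lq pq; rewrite dotE; apply: orth => // /(can_inj (@cons_rVK R n)).
  exact: pq.
- move=> f fL.
  pose g := f \o @uncons_rV R n.
  have gE : g \o @cons_rV R n = f by apply/funext => z; rewrite /g/= cons_rVK.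
  have mg : cmeasurable_fun g.
    by apply: cmeasurable_comp (@measurable_uncons_rV R n) _; case: fL.
  have gL : L2int (cylinder_rV rho) g by apply/(L2int_push mcons tauE mg); rewrite gE.
  have := cpl _ gL => /(approximable_push mcons tauE (fun l _ => eL l) gL).
  rewrite gE; apply: (approximable_reindex (h := @uncons_rV R n)) => l Ll.
    by rewrite /= uncons_rVK.
  by rewrite -pE uncons_rVK.
- move=> l l' Ll Ll' ll'; rewrite -(uncons_rVK l) -(uncons_rVK l') -dotE.
  apply: orth; rewrite /= ?uncons_rVK// => /(can_inj (@uncons_rVK R n)).
  exact: ll'.
- move=> f fL; apply/(approximable_push mcons tauE (fun l _ => eL l) fL).
  have fcL : L2int (rho \x U)%E (f \o @cons_rV R n).
    by apply/(L2int_push mcons tauE) => //; case: fL.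
  apply: approximable_reindex (cpl _ fcL) => [p Lp|p Lp]; first exact: Lp.
  by rewrite pE.
Qed.

Lemma spectral_cylinder_rV (rho : {finite_measure set 'rV[R]_n -> \bar R}) :
  rho setT <> 0%E ->
  spectral_measure (cylinder_rV rho) <-> spectral_measure rho.
Proof.
move=> rho0; have tau0 : cylinder_rV rho setT <> 0%E by rewrite cylinder_rVT.
rewrite (spectral_measureP rho0); apply: (iff_trans (spectral_measureP tau0)).
split=> -[L cL].
  move=> /complete_orthogonal_cons/spectrum_base h; eexists; last exact: h.
  (* The base frequencies are tails of elements of [L], hence contained in a countable image. *)
  apply: (@sub_countable _ _ _ ((fst \o @uncons_rV R n) @` L)); last first.
    exact: sub_countable (card_image_le _ _) cL.
  apply: subset_card_le => l [s Ls _]; exists (cons_rV (l, s)) => //.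
  exact: (congr1 fst (cons_rVK _)).
move=> /spectrum_cylinder h.
pose D := L `*` range (fun z : int => z%:~R : R).
exists (@cons_rV R n @` D).
  apply: sub_countable (card_image_le _ _) _; apply: countableX => //.
  by apply: sub_countable (card_image_le _ _) _.
apply/complete_orthogonal_cons.
suff -> : @cons_rV R n @^-1` (@cons_rV R n @` D) = D by [].
apply/seteqP; split => [p /= [q Dq /(can_inj (@cons_rVK R n)) <-]//|p Dp].
by exists p.
Qed.

End cylinder_rV.

(** * The cube as an iterated cylinder, and the theorem *)

Section cube.
Context (R : realType).
Local Notation U := (@unit_lebesgue R).

Lemma unit_cube_cons n (x : 'rV[R]_n) (t : R) :
  unit_cube R n.+1 (cons_rV (x, t)) <-> unit_cube R n x /\ 0 <= t <= 1.
Proof.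
split=> [h|[hx ht] i].
  split; last by have := h ord0; rewrite cons_rV_ord0 !mxE.
  by move=> i; have := h (lift ord0 i); rewrite cons_rV_lift !mxE.
case: (unliftP ord0 i) => [j|] ->; last by rewrite cons_rV_ord0 !mxE.
by rewrite cons_rV_lift; have := hx j; rewrite !mxE.
Qed.

(** Same recursion as [lebesgue_rV], with the interval restricted at each stage instead of the cube
    at the end; each stage is thus finite and of cylinder form. *)
Fixpoint cube_measure n : {finite_measure set 'rV[R]_n -> \bar R} :=
  match n with
  | 0 => \d_(0 : 'rV[R]_0)
  | n'.+1 => cylinder_rV (cube_measure n')
  end.

Lemma ge0_integral_mrestr d (T : measurableType d) (mu : {measure set T -> \bar R})
    (D : set T) (mD : measurable D) (f : T -> \bar R) :
  measurable_fun setT f -> (forall x, 0 <= f x)%E ->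
  (\int[mrestr mu mD]_x f x = \int[mu]_(x in D) f x)%E.
Proof.
move=> mf f0; rewrite (@ge0_negligible_integral _ _ _ (mrestr mu mD) _ (~` D))//.
- rewrite setDE setTI setCK; apply: eq_measure_integral => A mA AD.
  by rewrite /mrestr; congr (mu _); exact/setIidPl.
- exact: measurableC.
- by rewrite /= /mrestr setICl measure0.
Qed.

Lemma measurable_preimage_cons n (A : set 'rV[R]_n.+1) : measurable A ->
  measurable (@cons_rV R n @^-1` A : set ('rV[R]_n * measurableTypeR R)).
Proof.
move=> mA; rewrite -[X in measurable X]setTI; exact: measurable_cons_rV.
Qed.

(** By induction through sections: over a tail in the smaller cube, restricting to the cube
    restricts the section to [0, 1]. *)
Lemma cube_measureE n (A : set 'rV[R]_n) : measurable A ->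
  mrestr (lebesgue_rV R n) (measurable_unit_cube R n) A = cube_measure n A.
Proof.
elim: n A => [|n IH] A mA.
  rewrite /mrestr/=; congr (dirac _ _); apply/seteqP; split => [x []//|x Ax].
  by split => //; case.
have mB := measurable_preimage_cons mA.
transitivity (\int[lebesgue_rV R n]_(x in unit_cube R n)
    U (xsection (@cons_rV R n @^-1` A) x))%E.
  rewrite /mrestr /= /lebesgue_cons /pushforward /product_measure1 [RHS]integral_mkcond.
  apply: eq_integral => x _; rewrite patchE; case: ifPn => xC /=.
    apply: etrans (esym (unit_lebesgueE _)); congr lebesgue_measure.
    apply/seteqP; split => t; rewrite /xsection/=.
      move=> /set_mem[At /unit_cube_cons[_ t01]].
      by split; [exact/mem_set|rewrite /= in_itv].
    move=> [/set_mem At]; rewrite /= in_itv/= => t01; apply/mem_set.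
    by split => //; apply/unit_cube_cons; split => //; exact/set_mem.
  (* Over a tail outside the smaller cube the restricted set has empty section. *)
  rewrite [X in lebesgue_measure X](_ : _ = set0) ?measure0//.
  apply/seteqP; split => t //; rewrite /xsection/= !inE/=.
  by move=> [_ /unit_cube_cons[/mem_set]]; rewrite (negbTE xC).
have mf := measurable_fun_xsection U mB.
rewrite -(ge0_integral_mrestr _ (measurable_unit_cube R n) mf)//.
by apply: eq_measure_integral => B mB' _; exact: IH.
Qed.

Lemma ge0_integral_cylinder_rV n (rho : {finite_measure set 'rV[R]_n -> \bar R})
    (f : 'rV[R]_n.+1 -> \bar R) :
  measurable_fun setT f -> (forall x, 0 <= f x)%E ->
  (\int[cylinder_rV rho]_x f x = \int[rho]_x \int[U]_t f (cons_rV (x, t)))%E.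
Proof.
move=> mf f0.
have mcons : measurable_fun setT (@cons_rV R n : 'rV[R]_n * measurableTypeR R -> _).
  exact: measurable_cons_rV.
transitivity (\int[rho \x U]_z (f \o @cons_rV R n) z)%E.
  exact: (ge0_integral_pushforward mcons (rho \x U)%E measurableT mf).
by rewrite (fubini_tonelli1 _ (measurableT_comp mf mcons))// => z; exact: f0.
Qed.

Lemma ge0_integral_product_rV d m (mu : {finite_measure set 'rV[R]_d -> \bar R})
    (nu : {finite_measure set 'rV[R]_m -> \bar R}) (f : 'rV[R]_(d + m) -> \bar R) :
  measurable_fun setT f -> (forall x, 0 <= f x)%E ->
  (\int[product_rV mu nu]_x f x = \int[mu]_x \int[nu]_y f (row_mx x y))%E.
Proof.
move=> mf f0; have mrow := @measurable_row_mx R d m.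
transitivity (\int[mu \x nu]_z (f \o (fun p => row_mx p.1 p.2)) z)%E.
  exact: (ge0_integral_pushforward mrow (mu \x nu)%E measurableT mf).
by rewrite (fubini_tonelli1 _ (measurableT_comp mf mrow))// => z; exact: f0.
Qed.

Fixpoint iter_cylinder m (nu : {finite_measure set 'rV[R]_m -> \bar R}) d :
    {finite_measure set 'rV[R]_(d + m) -> \bar R} :=
  match d with
  | 0 => nu
  | d'.+1 => cylinder_rV (iter_cylinder nu d')
  end.

Lemma row_mx_cons d m (y : 'rV[R]_d) (t : R) (x : 'rV[R]_m) :
  row_mx (cons_rV (y, t)) x = cons_rV (row_mx y x, t) :> 'rV_(d.+1 + m).
Proof.
apply/rowP => i; case: (split_ordP i) => j ->.
  rewrite row_mxEl; case: (unliftP ord0 j) => [k|] ->.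
    rewrite cons_rV_lift.
    have -> : lshift m (lift ord0 k) = lift ord0 (lshift m k) by apply/val_inj.
    by rewrite (cons_rV_lift (n := d + m)) row_mxEl.
  rewrite cons_rV_ord0.
  have -> : lshift m (ord0 : 'I_d.+1) = ord0 by apply/val_inj.
  by rewrite (cons_rV_ord0 (n := d + m)).
rewrite row_mxEr.
have -> : rshift d.+1 j = lift ord0 (rshift d j) by apply/val_inj.
by rewrite (cons_rV_lift (n := d + m)) row_mxEr.
Qed.

Lemma row_mx_thin m (y : 'rV[R]_0) (x : 'rV[R]_m) :
  row_mx y x = x :> 'rV_(0 + m).
Proof.
apply/rowP => i; case: (split_ordP i) => [[]//|j ->].
by rewrite row_mxEr; congr (x 0 _); exact/val_inj.
Qed.

Lemma measurable_row_mx_preimage d m (A : set 'rV[R]_(d + m)) : measurable A ->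
  measurable ((fun p : 'rV[R]_d * 'rV[R]_m => row_mx p.1 p.2) @^-1` A).
Proof.
by move=> mA; rewrite -[X in measurable X]setTI; exact: measurable_row_mx.
Qed.

Lemma integral_xsection_ysection d1 d2 (T1 : measurableType d1)
    (T2 : measurableType d2) (m1 : {sigma_finite_measure set T1 -> \bar R})
    (m2 : {sigma_finite_measure set T2 -> \bar R}) (A : set (T1 * T2)) :
  measurable A ->
  (\int[m1]_x m2 (xsection A x) = \int[m2]_y m1 (ysection A y))%E.
Proof.
move=> mA; have := indic_fubini_tonelli m1 m2 mA.
by rewrite (indic_fubini_tonelli_FE m2 mA) (indic_fubini_tonelli_GE m1 mA).
Qed.

(** Associativity of the product, up to an exchange: the new coordinate t is paired with the cube on
    the left and with the pair (y, x) on the right. For fixed y, Tonelli on the section [P y] swaps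
    t and x. *)
Lemma product_cube_measure d m (nu : {finite_measure set 'rV[R]_m -> \bar R})
    (A : set 'rV[R]_(d + m)) : measurable A ->
  product_rV (cube_measure d) nu A = iter_cylinder nu d A.
Proof.
elim: d A => [|d IH] A mA.
  rewrite /product_rV /pushforward /product_measure1/=.
  have mA' := measurable_row_mx_preimage mA.
  rewrite integral_dirac//; last exact: (measurable_fun_xsection nu mA').
  rewrite diracT mul1e /=; congr (nu _); apply/seteqP; split => x.
    by move=> /set_mem; rewrite /preimage/= row_mx_thin.
  by move=> Ax; apply/mem_set; rewrite /preimage/= row_mx_thin.
have mA' := measurable_row_mx_preimage mA.
pose P (y : 'rV[R]_d) : set ('rV[R]_m * measurableTypeR R) :=
  [set p | A (cons_rV (row_mx y p.1, p.2))].
have mP y : measurable (P y).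
  have mh : measurable_fun setT (fun p : 'rV[R]_m * measurableTypeR R =>
      cons_rV (row_mx y p.1, p.2) : 'rV[R]_(d + m).+1).
    apply: (measurableT_comp (@measurable_cons_rV R (d + m))).
    apply/measurable_fun_pairP; split; last exact: measurable_snd.
    have mp : measurable_fun setT
        (fun p : 'rV[R]_m * measurableTypeR R => (y, p.1)).
      apply/measurable_fun_pairP; split; first exact: measurable_cst.
      exact: measurable_fst.
    exact: (measurableT_comp (@measurable_row_mx R d m) mp).
  by rewrite -[X in measurable X]setTI; exact: mh.
transitivity (\int[cube_measure d]_y \int[U]_t nu (ysection (P y) t))%E.
  have mf := measurable_fun_xsection nu mA'.
  apply: (etrans (ge0_integral_cylinder_rV _ mf _)) => //.
  apply: eq_integral => y _; apply: eq_integral => t _ /=; congr (nu _).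
  by apply/seteqP; split => x; rewrite /xsection /ysection/= !inE /P/= row_mx_cons.
transitivity (\int[cube_measure d]_y \int[nu]_x U (xsection (P y) x))%E.
  by apply: eq_integral => y _; rewrite integral_xsection_ysection.
have mB := measurable_preimage_cons (mA : measurable (A : set 'rV[R]_(d + m).+1)).
have mg := measurable_fun_xsection U mB.
transitivity (\int[product_rV (cube_measure d) nu]_w
    U (xsection (@cons_rV R (d + m) @^-1` A) w))%E; last first.
  by apply: eq_measure_integral => B mB' _; exact: IH.
by rewrite (ge0_integral_product_rV _ _ mg).
Qed.

End cube.

Theorem corollary1p4 (R : realType) (d m : nat)
    (nu : {finite_measure set 'rV[R]_m -> \bar R}) :
  (1 <= d)%N -> nu setT <> 0%E -> compact (msupport nu) ->
  spectral_measure
    (product_rV (mrestr (lebesgue_rV R d) (measurable_unit_cube R d)) nu)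
  <-> spectral_measure nu.
Proof.
move=> _ nu0 _.
have E A : measurable A ->
    product_rV (mrestr (lebesgue_rV R d) (measurable_unit_cube R d)) nu A =
    iter_cylinder nu d A.
  move=> mA; rewrite -product_cube_measure//.
  rewrite /product_rV /pushforward /product_measure1.
  by apply: eq_measure_integral => B mB _; exact: cube_measureE.
(* Nonzero mass is carried along the induction because [spectral_cylinder_rV] requires it at each
   stage. *)
have [h0 h] : iter_cylinder nu d setT <> 0%E /\
    (spectral_measure (iter_cylinder nu d) <-> spectral_measure nu).
  elim: (d) => [|k [k0 IH]] //=; split; first by rewrite cylinder_rVT.
  exact: iff_trans (spectral_cylinder_rV k0) IH.
apply: iff_trans h; split; apply: spectral_measure_eq => A mA; [exact: E|exact/esym/E].
Qed.
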